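(* Let a controlled Markov model with absorbing state $x_{\rm A}$ and with a law invariant risk transition mapping $\sigma$ satisfy conditions (G0)--(G4) of the context, and suppose that it is risk-transient for the stationary deterministic Markov policy $\varPi=\{\pi,\pi,\dots\}$ with some weight function $w$ (the same $w$ for which $c$ is $w$-bounded in (G3)). Then a $w$-bounded function $v\in\mathcal V$ satisfies the equations $$v(x)=\sigma\big(c(x,\pi(x),\cdot)+v(\cdot),\,x,\,Q(x,\pi(x))\big),\quad x\in\widetilde{\mathcal X},\qquad v(x_{\rm A})=0,$$ if and only if $v(x)=J_\infty(\varPi,x)$ for all $x\in\mathcal X$, where $J_\infty(\varPi,x)=\lim_{T\to\infty}J_T(\varPi,x)$.
   Context: Model. The state space $\mathcal X$ and the control space $\mathcal U$ are Borel spaces (Borel subsets of Polish spaces). $U:\mathcal X\rightrightarrows\mathcal U$ is a measurable multifunction with nonempty values (feasible controls). The controlled transition kernel $Q$ is a measurable mapping from $\mathrm{graph}(U)$ to the set of probability measures on $\mathcal X$ (with the topology of weak convergence); $Q(x,u)$ denotes the measure and $Q(B|x,u)$ its value on a Borel set $B$. The cost is $c:\mathcal X\times\mathcal U\times\mathcal X\to\mathbb R$. There is an absorbing state $x_{\rm A}\in\mathcal X$ with $Q(\{x_{\rm A}\}|x_{\rm A},u)=1$ and $c(x_{\rm A},u,x_{\rm A})=0$ for all $u\in U(x_{\rm A})$. Put $\widetilde{\mathcal X}=\mathcal X\setminus\{x_{\rm A}\}$. Function spaces. Fix $p\in[1,\infty)$, $1/p+1/q=1$, and a reference probability measure $P_0$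 on $\mathcal X$; $\mathcal V=L_p(\mathcal X,\mathcal B,P_0)$ with $\mathcal B$ the Borel $\sigma$-field. $\mathcal V'$ is the space of signed measures on $\mathcal X$ absolutely continuous with respect to $P_0$ with density in $L_q(\mathcal X,\mathcal B,P_0)$, paired with $\mathcal V$ by $\langle\varphi,m\rangle=\int\varphi\,dm$ and endowed with the weak$^*$ topology; $\mathcal M=\{m\in\mathcal V': m\ge0,\ m(\mathcal X)=1\}$. Weights. $w:\mathcal X\to[1,\infty)$, $w\in\mathcal V$, is a weight function (only its values on $\widetilde{\mathcal X}$ matter). A function $g:\mathcal X\times\mathcal U\times\mathcal X\to\mathbb R$ is $w$-bounded if for some $C>0$, $|g(x,u,y)|\le C(w(x)+w(y))$ for all $x\in\mathcal X$, $u\in U(x)$, $y\in\mathcal X$; a function $v$ of the state is $w$-bounded if $|v(x)|\le Cw(x)$ for all $x$. For a kernel $A$ of nonnegative measures on $\widetilde{\mathcal X}$, $\|A\|_w=\sup_{x\in\widetilde{\mathcal X}}\frac1{w(x)}\int_{\widetilde{\mathcal X}}w(y)\,A(dy|x)$. Risk transition mapping. A measurable $\sigma:\mathcal V\times\mathcal X\times\mathcal M\to\mathbb R$ such that for all $x\in\mathcal X,m\in\mathcal M$ the functional $\sigma(\cdot,x,m)$ is a coherent risk measure on $\mathcal V$: convex, monotone ($\varphi\le\psi\Rightarrow\sigma(\varphi)\le\sigma(\psi)$), translation equivariant ($\sigma(a+\varphi)=a+\sigma(\varphi)$, $a\in\mathbb R$), positively homogeneous ($\sigma(\beta\varphi)=\beta\sigma(\varphi)$,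 $\beta\ge0$). It is law invariant if $\sigma(\varphi,x,\mu)=\sigma(\psi,x,\nu)$ for all $x$ whenever the distribution function of $\varphi$ under $\mu$ equals that of $\psi$ under $\nu$. Put $\mathcal A(x,m)=\partial_\varphi\sigma(0,x,m)$ (convex subdifferential at $0$), a closed convex subset of $\mathcal M$; one has $\sigma(\varphi,x,m)=\max_{\mu\in\mathcal A(x,m)}\langle\varphi,\mu\rangle$. Assumptions. (G0) $Q(x,u)\in\mathcal V'$ for all $x\in\mathcal X,u\in U(x)$. (G1) $Q$ is setwise continuous: $Q(B|x_k,u_k)\to Q(B|x,u)$ for all Borel $B$ whenever $(x_k,u_k)\to(x,u)$. (G2) The multifunction $\mathcal A$ is lower semicontinuous on $\mathcal X\times\mathcal M$ (with the weak$^*$ topology on $\mathcal M$): if $x_k\to x$, $m_k\to m$, $\mu\in\mathcal A(x,m)$, there are $\mu_k\in\mathcal A(x_k,m_k)$ with $\mu_k\to\mu$. (G3) $c$ is measurable, $w$-bounded, and $c(\cdot,\cdot,y)$ is lower semicontinuous for every $y\in\mathcal X$. (G4) $U(\cdot)$ is measurable and compact-valued. Policies and costs. A stationary deterministic Markov policy is $\varPi=\{\pi,\pi,\dots\}$ with a measurable decision rule $\pi:\mathcal X\to\mathcal U$, $\pi(x)\in U(x)$. Its finite-horizon risk is $$J_T(\varPi,x_1)=\rho_1^\varPi\Big(c(x_1,\pi(x_1),x_2)+\rho_2^\varPi\big(c(x_2,\pi(x_2),x_3)+\cdots+\rho_T^\varPi(c(x_T,\pi(x_T),x_{T+1}))\cdots\big)\Big),$$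 where the $\rho_t^\varPi$ are Markov one-step conditional risk measures all given by $\sigma$: $\rho_t^\varPi(g(x_t,\pi(x_t),x_{t+1}))=\sigma\big(g(x_t,\pi(x_t),\cdot),x_t,Q(x_t,\pi(x_t))\big)$. Explicitly, $J_0\equiv0$ and $J_T(\varPi,x)=\sigma\big(c(x,\pi(x),\cdot)+J_{T-1}(\varPi,\cdot),x,Q(x,\pi(x))\big)$. Multikernels. A multikernel is a measurable multifunction from a space to measures on that space; $M\lessdot\mathfrak M$ means that the kernel $M$ is a measurable selector of $\mathfrak M$. The composition $\mathfrak M_1\mathfrak M_2$ consists at $x$ of all $[M_1M_2](\cdot|x)=\int M_2(\cdot|y)\,M_1(dy|x)$ with $M_i\lessdot\mathfrak M_i$; $(\mathfrak M)^j$ is the $j$-fold composition; sums are pointwise Minkowski sums. The risk multikernel of $\pi$ is $\mathfrak M^\pi(x)=\mathcal A(x,Q(x,\pi(x)))$; $\widetilde{\mathfrak M}^\pi$ is the substochastic multikernel on $\widetilde{\mathcal X}$ obtained by restricting $x$ to $\widetilde{\mathcal X}$ and restricting each measure in $\mathfrak M^\pi(x)$ to $\widetilde{\mathcal X}$. Risk-transience. The model is risk-transient for $\varPi=\{\pi,\pi,\dots\}$ with weight function $w$ if there is a constant $K$ such that $\|M\|_w\le K$ for all $M\lessdot\sum_{j=1}^T(\widetilde{\mathfrak M}^\pi)^j$ and all $T\ge0$. *)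

(* Defs.v *)
From HB Require Import structures.
From mathcomp Require Import all_boot all_order all_algebra.
From mathcomp Require Import all_classical all_reals all_analysis.

Set Implicit Arguments.
Unset Strict Implicit.
Unset Printing Implicit Defensive.

Import Order.TTheory GRing.Theory Num.Theory.
Import numFieldNormedType.Exports.

Local Open Scope classical_set_scope.
Local Open Scope ring_scope.

(* A Borel space: a topological space homeomorphic, through [f], to a Borel
   subset of a Polish space [P], and carrying its Borel sigma-algebra. *)
HB.mixin Record isBorelSpace (R : realType) (d : measure_display) T
    & Topological T & Measurable d T := {
  borel_measurableE : @measurable d T = <<s @open T >> ;
  borel_embedding : exists (P : completePseudoMetricType R) (f : T -> P),
    [/\ hausdorff_space P,
        exists2 D : set P, countable D & dense D,
        injective f,
        (forall A : set T, open A <-> exists2 B, open B & A = f @^-1` B) &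
        <<s @open P >> (range f)]
}.

#[short(type="borelSpaceType")]
HB.structure Definition BorelSpace (R : realType) (d : measure_display) :=
  {T of Topological T & Measurable d T & isBorelSpace R d T}.

Section spaces.
Context (R : realType) (d : measure_display) (X : borelSpaceType R d).
Implicit Types (F : set (X -> R)) (m mu nu : probability X R).

Definition Lp (P0 : probability X R) (p : R) : set (X -> R) :=
  [set f | f \in Lfun P0 p%:E].

(* Elements of L_p are represented by functions; the open sets below are the
   sets whose trace on L_p is open for the L_p seminorm. *)
Definition Lp_open P0 (p : R) : set (set (X -> R)) :=
  [set O | forall f, Lp P0 p f -> O f ->
    exists2 e : R, 0 < e & forall g, Lp P0 p g ->
      ('N[P0]_(p%:E)[EFin \o (g \- f)%R] < e%:E)%E -> O g].

Definition pairing (f : X -> R) (m : {measure set X -> \bar R}) : R :=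
  \int[m]_y f y.

(* The coarsest topology on probability measures for which m |-> \int f dm is
   continuous for every f in F. *)
Definition test_topology F : topologicalType :=
  initial_topology (fun m : probability X R =>
    (fun f : F => pairing (\val f) m) : prod_topology (fun _ : F => R)).

Definition bounded_continuous : set (X -> R) :=
  [set f | continuous f /\ exists C : R, forall x, `|f x| <= C].

Definition weak_open : set (set (probability X R)) :=
  @open (test_topology bounded_continuous).

Definition weak_star_open P0 (p : R) : set (set (probability X R)) :=
  @open (test_topology (Lp P0 p)).

(* The probability measures with a density in L_q, 1/p + 1/q = 1. *)
Definition Mset (P0 : probability X R) (p : R) : set (probability X R) :=
  [set m | exists2 g : X -> R, g \in Lfun P0 (hoelder_conjugate p%:E) &
    forall B, measurable B -> m B = (\int[P0]_(y in B) (g y)%:E)%E].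

Definition weak_star_cvg P0 (p : R) (m_ : nat -> probability X R) m :=
  forall f, Lp P0 p f -> pairing f (m_ k) @[k --> \oo] --> pairing f m.

End spaces.

Section risk_mappings.
Context (R : realType) (d : measure_display) (X : borelSpaceType R d).
Context (P0 : probability X R) (p : R).
Local Notation V := (Lp P0 p).
Local Notation M := (Mset P0 p).

(* The order of L_p is the P0-almost sure one; monotonicity with respect to it
   makes [rho] compatible with P0-almost sure equality. *)
Definition coherent (rho : (X -> R) -> R) :=
  [/\ (forall (a : R) f g, 0 <= a <= 1 -> V f -> V g ->
         rho (fun y => a * f y + (1 - a) * g y)
         <= a * rho f + (1 - a) * rho g),
      (forall f g, V f -> V g -> {ae P0, forall y, f y <= g y} ->
         rho f <= rho g),
      (forall (a : R) f, V f -> rho (fun y => a + f y) = a + rho f) &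
      (forall (b : R) f, 0 <= b -> V f -> rho (fun y => b * f y) = b * rho f)].

(* [sigma] is only relevant on L_p * X * M: its measurability is the one with
   respect to the trace on that set of the product of the Borel sigma-algebras
   of L_p (norm topology), X, and M (weak* topology). *)
Definition measurable_risk (sigma : (X -> R) -> X -> probability X R -> R) :=
  forall B : set R, measurable B ->
  exists2 E : set ((X -> R) * X * probability X R),
    <<s [set D | exists O A W, [/\ Lp_open P0 p O, measurable A,
          weak_star_open P0 p W & D = O `*` A `*` W]] >> E &
    forall f x m, V f -> M m -> (E (f, x, m) <-> B (sigma f x m)).

Definition risk_transition_mapping
    (sigma : (X -> R) -> X -> probability X R -> R) :=
  measurable_risk sigma /\
  forall x m, M m -> coherent (fun f => sigma f x m).

Definition law_invariant (sigma : (X -> R) -> X -> probability X R -> R) :=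
  forall f g mu nu, V f -> V g -> M mu -> M nu ->
    (forall t : R, mu [set y | f y <= t] = nu [set y | g y <= t]) ->
    forall x, sigma f x mu = sigma g x nu.

(* Subgradients of a coherent risk measure at 0 are probability measures, so
   the subdifferential is taken as a subset of M. *)
Definition subdifferential (rho : (X -> R) -> R) (f0 : X -> R) :
    set (probability X R) :=
  [set mu | M mu /\ forall f, V f -> rho f0 + pairing (f \- f0) mu <= rho f].

Definition risk_envelope (sigma : (X -> R) -> X -> probability X R -> R)
    (x : X) (m : probability X R) : set (probability X R) :=
  subdifferential (fun f => sigma f x m) (fun=> 0).

End risk_mappings.

(* Multikernels on a measurable subset D of X. A measure on D is identified
   with the measure on X vanishing outside D, and the values of kernels at
   points outside D are immaterial. Only the measurability of the selecting
   kernels enters the relations below. *)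
Section multikernels.
Context (R : realType) (d : measure_display) (X : borelSpaceType R d).
Context (D : set X).

Definition multikernel := X -> set {measure set X -> \bar R}.

Definition selector (K : R.-ker X ~> X) (MM : multikernel) :=
  forall x, D x -> MM x (K x).

Definition mk_comp (MM1 MM2 : multikernel) : multikernel := fun x =>
  [set nu | exists K1 K2 : R.-ker X ~> X,
    [/\ selector K1 MM1, selector K2 MM2 &
        forall B, measurable B ->
          nu B = (\int[K1 x]_(y in D) K2 y B)%E]].

(* The j-fold composition, for j >= 1. *)
Definition mk_pow (MM : multikernel) (j : nat) : multikernel :=
  iter j.-1 (mk_comp MM) MM.

Definition mk_sum_pow (MM : multikernel) (T : nat) : multikernel := fun x =>
  [set nu | exists nu_ : nat -> {measure set X -> \bar R},
    (forall j, (1 <= j <= T)%N -> mk_pow MM j x (nu_ j)) /\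
    forall B, measurable B -> nu B = (\sum_(1 <= j < T.+1) nu_ j B)%E].

Definition wnorm (w : X -> R) (K : R.-ker X ~> X) : \bar R :=
  ereal_sup [set ((w x)^-1%:E * \int[K x]_(y in D) (w y)%:E)%E | x in D].

End multikernels.

Section model.
Context (R : realType) (dX dU : measure_display).
Context (X : borelSpaceType R dX) (U : borelSpaceType R dU).
Implicit Types (Uf : X -> set U) (Q : X -> U -> probability X R).
Implicit Types (c : X -> U -> X -> R) (w v : X -> R) (pi : X -> U).
Implicit Types (sigma : (X -> R) -> X -> probability X R -> R).

Definition measurable_multifunction Uf :=
  forall O : set U, open O -> measurable [set x | Uf x `&` O !=set0].

(* Q is measurable on graph(Uf), equipped with the trace sigma-algebra, for the
   topology of weak convergence on probability measures. *)
Definition controlled_kernel Uf Q :=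
  forall W, weak_open W -> exists2 E : set (X * U), measurable E &
    forall x u, Uf x u -> (E (x, u) <-> W (Q x u)).

Definition absorbing Uf Q c (xA : X) :=
  forall u, Uf xA u -> Q xA u [set xA] = 1%E /\ c xA u xA = 0.

Definition wbounded w v :=
  exists2 C : R, 0 < C & forall x, `|v x| <= C * w x.

Definition cost_wbounded Uf w c :=
  exists2 C : R, 0 < C &
    forall x u y, Uf x u -> `|c x u y| <= C * (w x + w y).

(* A probability measure lies in the dual V' iff it has a density in L_q. *)
Definition G0 P0 (p : R) Uf Q := forall x u, Uf x u -> Mset P0 p (Q x u).

Definition G1 Uf Q :=
  forall (B : set X), measurable B ->
  forall (x_ : nat -> X) (u_ : nat -> U) x u,
    (forall k, Uf (x_ k) (u_ k)) -> Uf x u ->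
    x_ @ \oo --> x -> u_ @ \oo --> u ->
    Q (x_ k) (u_ k) B @[k --> \oo] --> Q x u B.

Definition G2 P0 (p : R) sigma :=
  forall (x_ : nat -> X) (m_ : nat -> probability X R) x m mu,
    (forall k, Mset P0 p (m_ k)) -> Mset P0 p m ->
    x_ @ \oo --> x -> weak_star_cvg P0 p m_ m ->
    risk_envelope P0 p sigma x m mu ->
    exists2 mu_ : nat -> probability X R,
      forall k, risk_envelope P0 p sigma (x_ k) (m_ k) (mu_ k) &
      weak_star_cvg P0 p mu_ mu.

Definition G3 Uf w c :=
  [/\ measurable_fun setT (fun z : X * U * X => c z.1.1 z.1.2 z.2),
      cost_wbounded Uf w c &
      forall y, lower_semicontinuous (fun z : X * U => (c z.1 z.2 y)%:E)].

Definition G4 Uf :=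
  measurable_multifunction Uf /\ forall x, compact (Uf x).

Definition decision_rule Uf pi :=
  measurable_fun setT pi /\ forall x, Uf x (pi x).

Fixpoint J Q c sigma pi (T : nat) (x : X) : R :=
  if T is T'.+1 then
    sigma (fun y => c x (pi x) y + J Q c sigma pi T' y) x (Q x (pi x))
  else 0.

Definition transient_states (xA : X) : set X := ~` [set xA].

(* At each x, the restrictions to X \ {xA} of the measures in
   risk_envelope x (Q x (pi x)). *)
Definition risk_multikernel P0 (p : R) Q sigma (xA : X) pi :
    multikernel X := fun x =>
  [set nu | exists2 mu, risk_envelope P0 p sigma x (Q x (pi x)) mu &
    forall B, measurable B -> nu B = mu (B `&` transient_states xA)].

Definition risk_transient P0 (p : R) Q sigma (xA : X) w pi :=
  exists K : R, forall (T : nat) (N : R.-ker X ~> X),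
    selector (transient_states xA) N
      (mk_sum_pow (transient_states xA)
         (risk_multikernel P0 p Q sigma xA pi) T) ->
    (wnorm (transient_states xA) w N <= K%:E)%E.

End model.

(* Main.v *)
(** Write s_x f for the risk of f at the state x under the policy, and S for the
    operator f |-> (x |-> s_x f). If S phi_j = phi_(j+1), where phi_0 is the weight
    w cut off at the absorbing state, then risk transience bounds
    phi_1 + ... + phi_T by K w. As phi_(n+j) <= K phi_j, this gives
    T phi_T <= K^2 w, so that phi_T tends to 0. Subadditivity of s_x turns a bound
    |f - g| <= a phi_j into the bound a phi_(j+1) for the images of f and g under
    the operator v |-> (x |-> s_x (c_x + v)). Both implications follow by iterating
    this estimate, starting from v and 0 or from J_n and 0.

    To apply transience, every s_x (phi_j) must be attained by a measurable kernel
    selecting from the risk envelopes. Replacing a sublinear functional s by its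
    one-sided derivative s'(h; .) keeps the value at h and makes it linear along h.
    Doing this successively for h = phi_j and for a countable family dense in L_p
    leaves in the limit a linear functional below s_x, which is measurable in x by
    construction and, by automatic continuity of coherent risk measures and the
    Radon-Nikodym theorem, is given by a density in L_q. *)

From HB Require Import structures.
Require Import Defs.
From mathcomp Require Import all_boot all_order all_algebra.
From mathcomp Require Import all_classical all_reals all_analysis.
From mathcomp Require Import measurable_realfun.
From mathcomp Require Import ring lra.
Import Order.TTheory GRing.Theory Num.Theory.
Import numFieldNormedType.Exports.
Set Implicit Arguments. Unset Strict Implicit. Unset Printing Implicit Defensive.
Local Open Scope classical_set_scope.
Local Open Scope ring_scope.

(** * Second countability of Borel spaces *)

Section second_countability.
Context (R : realType) (d : measure_display) (T : borelSpaceType R d).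

(** Two obstacles shape the development. First, [sigma] is measurable only for the Borel sets of the
    weak star topology, which in general has no countable base on the whole set of densities, so
    that even the measurability of the risk at a fixed function along the policy needs an argument.
    The maximizing measures are therefore not chosen by a selection theorem but computed as iterated
    limits of values of [sigma]. Coherence contains no continuity assumption; continuity follows
    from finiteness on all of L_p, and it is used three times: for the density in L_q, for passing
    from a dense family to all of L_p, and for comparing densities on bounded sets.

    Second, S phi_j makes sense only for phi_j in L_p. This membership comes from the transience
    bound, and the bound needs kernels attaining the iterates, which are built from earlier
    memberships; all of it is proved by one induction. Although S is not linear, an iterate of S is
    an integral of the weight under a single kernel, because each factor of a composition of
    multikernels may use its own selector. *)

Lemma open_measurable_borel (O : set T) : open O -> measurable O.
Proof. by move=> oO; rewrite (@borel_measurableE R d T); exact: sub_sigma_algebra. Qed.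

(** The base consists of preimages of interiors of balls of radius 1/(k+1) about the points of a
    countable dense set. Interiors are taken because balls here need not be open. *)
Lemma borel_countable_base : exists b : nat -> set T,
  (forall i, open (b i)) /\
  forall (x : T) O, open O -> O x -> exists2 i, b i x & b i `<=` O.
Proof.
have [P [f [_ [D cD dD] _ fO _]]] := @borel_embedding R d T.
(* If the dense set is empty, then [T] has no point. *)
have /pfcard_geP[D0|[e]] := cD.
  exists (fun=> set0); split=> [_|x]; first exact: open0.
  have [|y] := dD setT _ openT; first by exists (f x).
  by rewrite D0 setI0.
pose b n := let: (i, k) := odflt (0, 0)%N (unpickle n) in
  f @^-1` (ball (e i) (k.+1%:R^-1 : R))°.
exists b; split=> [n|x O oO Ox].
  rewrite /b; case: (odflt _ _) => i k; apply/fO; exists (ball (e i) k.+1%:R^-1)° => //.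
  exact: open_interior.
have [B oB OB] := (fO O).1 oO.
have /nbhs_ballP[r /= r0 rB] : nbhs (f x) B.
  by apply: open_nbhs_nbhs; split => //; move: Ox; rewrite OB.
pose k := Num.truncn (2 / r).
have kr : k.+1%:R^-1 < r / 2.
  by rewrite invf_plt ?posrE ?divr_gt0// invf_div; exact: truncnS_gt.
have k20 : 0 < (k.+1%:R^-1 / 2 : R) by rewrite divr_gt0// invr_gt0.
(* The centre is taken within half the radius of [f x]: a whole ball about [f x] then fits into the
   basic ball, and [f x] lies in its interior. *)
have [z [/interior_subset + [i _ ez]]] : (ball (f x) (k.+1%:R^-1 / 2))° `&` (e @` setT) !=set0.
  rewrite -(_ : D = e @` setT); last by apply/esym/image_eq.
  apply: dD; last exact: open_interior.
  by exists (f x); apply: nbhsx_ballx.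
rewrite -ez => fy.
exists (pickle (i, k)); rewrite /b pickleK/=.
  have : nbhs (f x) (ball (f x) (k.+1%:R^-1 / 2)) by exact: nbhsx_ballx.
  by apply: filterS => t ft; exact: ball_split (ball_sym fy) ft.
move=> y /= /interior_subset ey; rewrite OB; apply: rB.
have : ball (f x) (k.+1%:R^-1 / 2 + k.+1%:R^-1) (f y) by exact: ball_triangle fy ey.
by apply: le_ball; move: kr k20; move: (k.+1%:R^-1 : R) => u ur u0; lra.
Qed.

(* The n-th chosen basic neighbourhood of x lies in the first n ones around x. *)
Lemma borel_countable_base_cvg : exists b : nat -> set T,
  (forall i, open (b i)) /\ forall x : T, exists i_ : nat -> nat,
    (forall n, b (i_ n) x) /\
    forall x_ : nat -> T, (forall n, b (i_ n) (x_ n)) -> x_ @ \oo --> x.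
Proof.
have [b [ob bP]] := borel_countable_base; exists b; split => // x.
pose C i := if `[< b i x >] then b i else setT.
pose A := fix A n := if n is m.+1 then C m `&` A m else setT.
have oA n : open (A n).
  elim: n => [|n IH]; first exact: openT.
  by apply: openI => //; rewrite /C; case: asboolP => // _; exact: openT.
have Ax n : A n x by elim: n => [//|n IH]; split => //; rewrite /C; case: asboolP.
have Ab i n : b i x -> (i < n)%N -> A n `<=` b i.
  move=> bx; elim: n => // n IH; rewrite ltnS leq_eqVlt => /predU1P[ni|ni] y [].
    by rewrite -ni /C; case: asboolP.
  by move=> _; exact: IH.
have /choice[i_ Hi] : forall n, exists i, b i x /\ b i `<=` A n.
  by move=> n; have [i bx bA] := bP x _ (oA n) (Ax n); exists i.
exists i_; split=> [n|x_ Hx]; first exact: (Hi n).1.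
move=> B /=; rewrite nbhsE => -[G [oG Gx] GB].
have [i bx bG] := bP x G oG Gx.
exists i.+1 => // n /= ni; apply: GB; apply: bG.
exact: (Ab i n bx ni _ ((Hi n).2 _ (Hx n))).
Qed.

Lemma measurable_borel_set1 (x : T) : measurable [set x].
Proof.
have [P [f [hP _ fI fO _]]] := @borel_embedding R d T.
rewrite -[X in measurable X]setCK; apply: measurableC; apply: open_measurable_borel.
apply/fO; exists (~` [set f x]).
  by apply: closed_openC; apply: accessible_closed_set1; exact: hausdorff_accessible.
by apply/seteqP; split=> y /= H; [move=> /fI|move=> yx; apply: H; rewrite yx].
Qed.

End second_countability.

(** * Kernels *)

Section kernels.
Context (R : realType) (d : measure_display) (X : measurableType d).

Lemma integral_mrestr (m : {measure set X -> \bar R}) (D : set X) (mD : measurable D)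
    (f : X -> \bar R) : (forall x, (0 <= f x)%E) -> measurable_fun setT f ->
  (forall x, ~ D x -> f x = 0%E) -> (\int[mrestr m mD]_x f x = \int[m]_x f x)%E.
Proof.
move=> f0 mf fD; have mDC : measurable (~` D) by exact: measurableC.
have -> : (\int[m]_x f x = \int[measure_add (mrestr m mD) (mrestr m mDC)]_x f x)%E.
  apply: eq_measure_integral => B mB _.
  transitivity (mrestr m mD B + mrestr m mDC B)%E; last by rewrite -measure_addE.
  rewrite /= /mrestr -measureU; first by rewrite -setIUr setUv setIT.
  - exact: measurableI.
  - exact: measurableI.
  - by rewrite setIACA setICr setI0.
rewrite ge0_integral_measure_add//.
rewrite [X in (_ + X)%E](_ : _ = 0%E) ?adde0//.
transitivity (\int[mrestr m mDC]_x (cst 0%E x))%E; last by rewrite integral0.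
apply: ae_eq_integral => //; exists D; split => //.
  by rewrite /= /mrestr setICr measure0.
move=> x /= /not_implyP[_ fx]; apply: contrapT => Dx; apply: fx.
exact: fD.
Qed.

Lemma integral_support (m : {measure set X -> \bar R}) (D : set X) (f : X -> \bar R) :
  measurable D -> m (~` D) = 0%E -> (forall x, (0 <= f x)%E) -> measurable_fun setT f ->
  (\int[m]_(x in D) f x = \int[m]_x f x)%E.
Proof.
move=> mD mDC f0 mf; rewrite [RHS](ge0_negligible_integral (measurableC mD))//.
by rewrite setTD setCK.
Qed.

Section restriction.
Context (k : X -> probability X R) (D : set X) (mD : measurable D).
Context (mk : forall B, measurable B -> measurable_fun setT (fun x => k x B)).

Let restriction x : {measure set X -> \bar R} := mrestr (k x) mD.

Let measurable_restriction B : measurable B -> measurable_fun setT (restriction ^~ B).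
Proof. by move=> mB; apply: mk; exact: measurableI. Qed.

HB.instance Definition _ := isKernel.Build _ _ _ _ R restriction measurable_restriction.

Let restriction_le1 : (ereal_sup [set restriction x setT | x in setT] <= 1)%E.
Proof.
by apply: ge_ereal_sup => _ [x _ <-]; apply: probability_le1; exact: measurableI.
Qed.

HB.instance Definition _ := Kernel_isSubProbability.Build _ _ _ _ R restriction restriction_le1.

Lemma restricted_kernel : exists K : R.-fker X ~> X,
  (forall x B, K x B = k x (B `&` D)) /\
  forall x (f : X -> \bar R), (forall y, (0 <= f y)%E) -> measurable_fun setT f ->
    (forall y, ~ D y -> f y = 0%E) -> (\int[K x]_y f y = \int[k x]_y f y)%E.
Proof. by exists restriction; split => // x f f0 mf fD; exact: integral_mrestr. Qed.

End restriction.

Section composition.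
Context (K1 K2 : R.-fker X ~> X).

(** [mkcomp] expects its second kernel on pairs; this one forgets the initial state. *)
Let K2snd (z : X * X) : {measure set X -> \bar R} := K2 z.2.

Let measurable_K2snd B : measurable B -> measurable_fun setT (K2snd ^~ B).
Proof. by move=> mB; exact: (measurableT_comp (measurable_kernel K2 B mB) measurable_snd). Qed.

HB.instance Definition _ := isKernel.Build _ _ _ _ R K2snd measurable_K2snd.

Let K2snd_uub : measure_fam_uub K2snd.
Proof. by have [r Kr] := measure_uub K2; exists r => z; exact: Kr. Qed.

HB.instance Definition _ := Kernel_isFinite.Build _ _ _ _ R K2snd K2snd_uub.

Import KCOMP_FINITE_KERNEL.

Lemma composed_kernel : exists K : R.-fker X ~> X,
  (forall x B, K x B = (\int[K1 x]_y K2 y B)%E) /\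
  forall x (f : X -> \bar R), (forall y, (0 <= f y)%E) -> measurable_fun setT f ->
    (\int[K x]_y f y = \int[K1 x]_y \int[K2 y]_z f z)%E.
Proof.
exists (mkcomp K1 K2snd); split => // x f f0 mf.
exact: (@integral_kcomp _ _ _ _ _ _ _ K1 K2snd).
Qed.

End composition.
End kernels.

(** * The space L_p and coherent risk measures *)

Section Lp_space.
Context (R : realType) (d : measure_display) (X : borelSpaceType R d).
Context (P0 : probability X R) (p : R).
Context (p_ge1 : 1 <= p).
Local Notation V := (Lp P0 p).
Implicit Types f g : X -> R.

(** The p-th power of the L_p seminorm. Without the root it stays a plain integral; homogeneity of
    degree p and subadditivity up to the factor 2^p are enough for all estimates. *)
Definition Np f : \bar R := (\int[P0]_y (`|f y| `^ p)%:E)%E.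

Let p_gt0 : 0 < p. Proof. exact: lt_le_trans ltr01 p_ge1. Qed.
Let p_neq0 : p != 0. Proof. by rewrite gt_eqF. Qed.
Let p_ge0 : 0 <= p. Proof. exact: ltW. Qed.

Lemma measurable_norm_powR f : measurable_fun setT f ->
  measurable_fun setT (fun y => `|f y| `^ p).
Proof.
move=> mf; apply: (measurableT_comp (measurable_powR _)).
exact: measurableT_comp.
Qed.

Lemma Np_ge0 f : (0 <= Np f)%E.
Proof. by apply: integral_ge0 => y _; rewrite lee_fin powR_ge0. Qed.

Lemma LpP f : V f <-> measurable_fun setT f /\ (Np f < +oo)%E.
Proof.
split=> [Vf|[mf Nf]].
  have /andP[/[!inE]/= mf _] := Vf; split=> //.
  exact/integrable_lty/(Lfun_integrable p_ge1).
rewrite /Lp /= inE; apply/andP; split; rewrite inE//=.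
rewrite /finite_norm unlock /Lnorm poweR_lty//.
Qed.

Lemma Lp_measurable f : V f -> measurable_fun setT f.
Proof. by case/LpP. Qed.

Lemma ae_le_Np f g : measurable_fun setT f -> measurable_fun setT g ->
  {ae P0, forall y, `|f y| <= `|g y|} -> (Np f <= Np g)%E.
Proof.
move=> mf mg fg; apply: ae_ge0_le_integral => //.
- exact/measurable_EFinP/measurable_norm_powR.
- exact/measurable_EFinP/measurable_norm_powR.
- apply: filterS fg => y + _; move=> fgy; rewrite lee_fin.
  by rewrite ge0_ler_powR ?nnegrE.
Qed.

Lemma le_Np f g : measurable_fun setT f -> measurable_fun setT g ->
  (forall y, `|f y| <= `|g y|) -> (Np f <= Np g)%E.
Proof. by move=> mf mg fg; apply: ae_le_Np => //; apply: aeW => y; exact: fg. Qed.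

Lemma Lp_le f g : measurable_fun setT f -> V g ->
  (forall y, `|f y| <= `|g y|) -> V f.
Proof.
move=> mf /LpP[mg Ng] fg; apply/LpP; split; first exact: mf.
exact: le_lt_trans (le_Np mf mg fg) Ng.
Qed.

Lemma NpZ a f : measurable_fun setT f ->
  Np (fun y => a * f y) = ((`|a| `^ p)%:E * Np f)%E.
Proof.
move=> mf; rewrite /Np -ge0_integralZl//.
- by apply: eq_integral => y _; rewrite normrM powRM// EFinM.
- exact/measurable_EFinP/measurable_norm_powR.
Qed.

Lemma NpN f : Np (fun y => - f y) = Np f.
Proof. by apply: eq_integral => y _; rewrite normrN. Qed.

Lemma NpB f g : Np (fun y => f y - g y) = Np (fun y => g y - f y).
Proof. by apply: eq_integral => y _; rewrite distrC. Qed.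

Lemma powR_normD (a b : R) :
  `|a + b| `^ p <= 2 `^ p * (`|a| `^ p + `|b| `^ p).
Proof.
have ab : `|a + b| <= 2 * Num.max `|a| `|b|.
  apply: le_trans (ler_normD _ _) _; rewrite mulr_natl mulr2n lerD//.
    by rewrite le_max lexx.
  by rewrite le_max lexx orbT.
have m0 : 0 <= Num.max `|a| `|b| by rewrite le_max normr_ge0.
apply: le_trans (ge0_ler_powR p_ge0 _ _ ab) _; rewrite ?nnegrE ?mulr_ge0//.
rewrite powRM// ler_wpM2l ?powR_ge0//.
by case: (leP `|a| `|b|) => _; rewrite ?lerDr ?lerDl powR_ge0.
Qed.

Lemma Np_add f g : measurable_fun setT f -> measurable_fun setT g ->
  (Np (fun y => (f y + g y)%R) <= (2 `^ p)%:E * (Np f + Np g))%E.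
Proof.
move=> mf mg.
have Ef := measurable_norm_powR mf; have Eg := measurable_norm_powR mg.
rewrite /Np -ge0_integralD//; last 2 first.
- exact/measurable_EFinP.
- exact/measurable_EFinP.
rewrite -ge0_integralZl//; last 2 first.
- by apply: emeasurable_funD; exact/measurable_EFinP.
- by move=> y _; rewrite -EFinD lee_fin addr_ge0 ?powR_ge0.
apply: ge0_le_integral => //.
- by apply/measurable_EFinP/measurable_norm_powR; exact: measurable_funD.
- by apply: emeasurable_funM => //; apply: emeasurable_funD; exact/measurable_EFinP.
- by move=> y _; rewrite -EFinD -EFinM lee_fin powR_normD.
Qed.

Lemma LpD f g : V f -> V g -> V (fun y => f y + g y).
Proof.
move=> /LpP[mf Nf] /LpP[mg Ng]; apply/LpP; split.
  exact: measurable_funD.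
apply: le_lt_trans (Np_add mf mg) _.
apply: lte_mul_pinfty; [by rewrite lee_fin powR_ge0|by []|].
exact: (lte_add_pinfty Nf Ng).
Qed.

Lemma LpZ a f : V f -> V (fun y => a * f y).
Proof.
move=> /LpP[mf Nf]; apply/LpP; split; first exact: measurable_funM.
by rewrite NpZ// lte_mul_pinfty ?lee_fin ?powR_ge0.
Qed.

Lemma LpN f : V f -> V (fun y => - f y).
Proof.
move=> /LpP[mf Nf]; apply/LpP; split; first exact: measurableT_comp.
by rewrite NpN.
Qed.

Lemma LpB f g : V f -> V g -> V (fun y => f y - g y).
Proof. by move=> Vf Vg; apply: LpD => //; exact: LpN. Qed.

Lemma Lp_cst a : V (fun=> a).
Proof. exact: Lfun_cst. Qed.

Lemma Lp_norm f : V f -> V (fun y => `|f y|).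
Proof.
move=> Vf; apply: (Lp_le _ Vf); last by move=> y; rewrite normr_id.
by apply: measurableT_comp => //; exact: Lp_measurable.
Qed.

Lemma Lp_indic B : measurable B -> V \1_B.
Proof.
move=> mB; apply: (Lp_le _ (Lp_cst 1)) => [|y].
  exact: measurable_indic.
by rewrite normr1 indicE; case: (_ \in _); rewrite ?normr1 ?normr0.
Qed.

Lemma Np_indic B : measurable B -> Np \1_B = P0 B.
Proof.
move=> mB; rewrite -[B in RHS]setIT -integral_indic//.
apply: eq_integral => y _; congr EFin; rewrite indicE.
by case: (_ \in _); rewrite ?normr1 ?powR1// normr0 powR0.
Qed.

Lemma Np_cvg0 (f_ : nat -> X -> R) g : V g ->
  (forall n, measurable_fun setT (f_ n)) ->
  (forall n y, `|f_ n y| <= g y) ->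
  (forall y, f_ n y @[n --> \oo] --> 0) ->
  Np (f_ n) @[n --> \oo] --> 0%E.
Proof.
move=> Vg mf fg f0; rewrite /Np.
have -> : 0%E = (\int[P0]_(y in setT) (cst 0 y))%E.
  by rewrite integral0.
have [] // := @dominated_convergence _ _ _ P0 setT measurableT
  (fun n y => (`|f_ n y| `^ p)%:E) (cst 0%E) (fun y => (`|g y| `^ p)%:E).
- by move=> n; exact/measurable_EFinP/measurable_norm_powR.
- apply: aeW => y _; apply: cvg_EFin; first by near=> n.
  rewrite -[X in _ --> X](powR0 p_neq0).
  apply/cvgrPdist_lt => e e0.
  have /cvgrPdist_lt /(_ (e `^ p^-1)) := f0 y.
  rewrite powR_gt0// => /(_ isT); apply: filterS => n.
  rewrite sub0r normrN powR0// sub0r normrN => fe.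
  rewrite ger0_norm ?powR_ge0//.
  have := @gt0_ltr_powR _ p p_gt0 `|f_ n y| (e `^ p^-1).
  rewrite -powRrM mulVf// powRr1 ?ltW//; apply => //.
  by rewrite nnegrE powR_ge0.
- exact: Lfun_integrable.
- apply: aeW => y n _; rewrite gee0_abs ?lee_fin ?powR_ge0//.
  rewrite ge0_ler_powR ?nnegrE//.
  exact: le_trans (fg n y) (ler_norm _).
Unshelve. all: by end_near. Qed.

Definition sublinear_on (s : (X -> R) -> R) :=
  (forall f g, V f -> V g -> s (fun y => f y + g y) <= s f + s g) /\
  (forall b f, 0 <= b -> V f -> s (fun y => b * f y) = b * s f).

Definition ae_le (f g : X -> R) := {ae P0, forall y, f y <= g y}.

Section coherent_theory.
Context (rho : (X -> R) -> R).
Context (coh : coherent P0 p rho).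

Lemma coherentZ b f : 0 <= b -> V f -> rho (fun y => b * f y) = b * rho f.
Proof. by case: coh => _ _ _; apply. Qed.

Lemma coherent_cst a f : V f -> rho (fun y => a + f y) = a + rho f.
Proof. by case: coh => ? ? + _; apply. Qed.

Lemma coherent_ae_le f g : V f -> V g -> ae_le f g -> rho f <= rho g.
Proof. by case: coh => _ + _ _; apply. Qed.

Lemma coherent_le f g : V f -> V g -> (forall y, f y <= g y) -> rho f <= rho g.
Proof. by move=> Vf Vg fg; apply: coherent_ae_le => //; apply: aeW => y; exact: fg. Qed.

Lemma coherentD f g : V f -> V g -> rho (fun y => f y + g y) <= rho f + rho g.
Proof.
move=> Vf Vg; case: coh => cvx _ _ _.
have h : 0 <= (2^-1 : R) <= 1 by lra.
have := cvx 2^-1 (fun y => 2 * f y) (fun y => 2 * g y) h (LpZ _ Vf) (LpZ _ Vg).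
rewrite !coherentZ ?ler0n//.
have -> : (fun y => 2^-1 * (2 * f y) + (1 - 2^-1) * (2 * g y)) =
  (fun y => f y + g y) by apply/funext => y; lra.
by move=> /le_trans; apply; lra.
Qed.

Lemma coherent0 : rho (fun=> 0) = 0.
Proof.
by have := coherentZ (lexx 0) (Lp_cst 0); rewrite !mul0r.
Qed.

Lemma coherent_sublinear : sublinear_on rho.
Proof. by split => *; [exact: coherentD|exact: coherentZ]. Qed.

Lemma coherentB f g : V f -> V g -> rho f - rho g <= rho (fun y => f y - g y).
Proof.
move=> Vf Vg; have := coherentD (LpB Vf Vg) Vg.
have -> : (fun y => f y - g y + g y) = f by apply/funext => y; rewrite subrK.
by rewrite lerBlDr.
Qed.

Lemma coherent_dist f g : V f -> V g ->
  `|rho f - rho g| <= rho (fun y => `|f y - g y|).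
Proof.
move=> Vf Vg; rewrite ler_norml -lerNl opprB; apply/andP; split.
  apply: le_trans (coherentB Vg Vf) _; apply: coherent_le.
  - exact: LpB.
  - exact/Lp_norm/LpB.
  - by move=> y; rewrite distrC ler_norm.
apply: le_trans (coherentB Vf Vg) _; apply: coherent_le.
- exact: LpB.
- exact/Lp_norm/LpB.
- by move=> y; rewrite ler_norm.
Qed.

(* A sequence of nonnegative functions tending to 0 fast in L_p has a weighted
   supremum in L_p, whose risk would be infinite if those of the functions did
   not tend to 0. *)
Lemma coherent_cont e : 0 < e -> exists2 dl, 0 < dl &
  forall f, V f -> (Np f <= dl%:E)%E -> rho (fun y => `|f y|) <= e.
Proof.
move=> e0; apply: contrapT => H.
have {}H dl : 0 < dl -> exists f, [/\ V f, (Np f <= dl%:E)%E &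
    e < rho (fun y => `|f y|)].
  move=> dl0; apply: contrapT => H'; apply: H; exists dl => // f Vf Nf.
  by rewrite leNgt; apply/negP => h; apply: H'; exists f.
(* With this threshold the p-th power of [2 ^+ k * f_ k] has integral at most 2^-(k+1), so that the
   sum over k is integrable. *)
pose dl k : R := (2 ^+ k) `^ (- p) * (2 ^+ k.+1)^-1.
have dl0 k : 0 < dl k by rewrite mulr_gt0 ?powR_gt0 ?invr_gt0 ?exprn_gt0.
have /choice[f_ /all_and3[Vf Nf rf]] := fun k => H (dl k) (dl0 k).
pose F k y : \bar R := (`|2 ^+ k * f_ k y| `^ p)%:E.
have mF k : measurable_fun setT (F k).
  by apply/measurable_EFinP/measurable_norm_powR/Lp_measurable/LpZ.
have F0 k y : (0 <= F k y)%E by rewrite lee_fin powR_ge0.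
pose h y := (\sum_(0 <= k <oo) F k y)%E.
have h0 y : (0 <= h y)%E by apply: nneseries_ge0 => *; exact: F0.
have mh : measurable_fun setT h.
  by apply: ge0_emeasurable_sum => // *; exact: F0.
have inth : (\int[P0]_y h y < +oo)%E.
  rewrite integral_nneseries//.
  apply: (@le_lt_trans _ _ 1%E); last by rewrite ltry.
  rewrite -[X in (_ <= X)%E](_ : (1 / 2 ^+ 0)%:E = _); last first.
    by rewrite expr0 divr1.
  rewrite -(cvg_lim _ (@cvg_geometric_eseries_half R 1 0))//.
  apply: lee_nneseries => k _; first by move=> _; exact: integral_ge0.
  rewrite -[X in (X <= _)%E]/(Np (fun y => 2 ^+ k * f_ k y)) NpZ; last first.
    exact: Lp_measurable.
  apply: (@le_trans _ _ ((`|2 ^+ k| `^ p)%:E * (dl k)%:E)%E).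
    by rewrite lee_wpmul2l// lee_fin powR_ge0.
  rewrite -EFinM lee_fin /dl mulrA ger0_norm// -powRD ?subrr; last first.
    by rewrite eqxx/= expf_neq0.
  by rewrite powRr0 !mul1r addn1 natrX.
have ih : P0.-integrable setT h.
  apply/integrableP; split => //.
  by under eq_integral do rewrite gee0_abs//.
have hfin := integrable_ae measurableT ih.
(* The p-th root of the sum dominates every 2^k |f_k| where the sum is finite, hence almost surely;
   thus [rho g] would exceed 2^k e for all k. *)
pose g y := fine (h y) `^ p^-1.
have gp y : `|g y| `^ p = fine (h y).
  rewrite ger0_norm ?powR_ge0// -powRrM mulVf// powRr1//.
  exact: fine_ge0.
have Vg : V g.
  apply/LpP; split.
    apply: (measurableT_comp (measurable_powR _)).
    exact: (measurableT_comp (fine_measurable measurableT)).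
  apply: le_lt_trans inth; apply: ge0_le_integral => //.
  - apply/measurable_EFinP; under eq_fun do rewrite gp.
    exact: (measurableT_comp (fine_measurable measurableT)).
  - move=> y _; rewrite gp.
    have [hy|hy] := boolP (h y \is a fin_num); first by rewrite fineK.
    have -> : h y = +oo%E by apply/eqP; move: hy; rewrite ge0_fin_numE// ltey negbK.
    by rewrite leey.
have le_k k : 2 ^+ k * e < rho g.
  apply: (@lt_le_trans _ _ (2 ^+ k * rho (fun y => `|f_ k y|))).
    by rewrite ltr_pM2l ?exprn_gt0.
  rewrite -coherentZ//; last exact: Lp_norm.
  apply: coherent_ae_le => //; first exact/LpZ/Lp_norm.
  apply: filterS hfin => y /(_ I) hy.
  have Fh : (F k y <= h y)%E.
    apply: le_trans (@nneseries_lim_ge R (F ^~ y) xpredT 0 k.+1 _); last first.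
      by move=> *; exact: F0.
    by rewrite big_nat_recr//= leeDr// sume_ge0.
  rewrite -(ger0_norm (exprn_ge0 k (ler0n R 2))) -normrM.
  have := @ge0_ler_powR _ p^-1 _ (`|2 ^+ k * f_ k y| `^ p) (fine (h y)).
  rewrite !nnegrE powR_ge0 -powRrM mulfV// powRr1// => -> //.
  - by rewrite invr_ge0.
  - exact: fine_ge0.
  - by rewrite -lee_fin fineK.
have [n hn] : exists n, rho g / e < n%:R.
  exists (Num.truncn (rho g / e)).+1.
  exact: truncnS_gt.
have := le_k n; rewrite ltNge => /negP; apply.
rewrite -ler_pdivrMr//; apply: le_trans (ltW hn) _.
by rewrite -natrX ler_nat ltnW// ltn_expl.
Qed.

End coherent_theory.

(** * Lexicographic subgradients *)

Section lexicographic_subgradient.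
Local Notation sublinear := sublinear_on.
Implicit Types (h : X -> R) (s : (X -> R) -> R).

Lemma sublinear0 s : sublinear s -> s (fun=> 0) = 0.
Proof.
by case=> _ sZ; have := sZ 0 _ (lexx 0) (Lp_cst 0); rewrite !mul0r.
Qed.

Lemma sublinear_oppr s f : sublinear s -> V f -> - s (fun y => - f y) <= s f.
Proof.
move=> ss Vf; rewrite lerNl -subr_ge0 opprK.
have := ss.1 _ _ (LpN Vf) Vf; under eq_fun do rewrite addNr.
by rewrite sublinear0.
Qed.

(** For r > 0 and t = 1/r this is (s(h + t f) - s h) / t, by positive homogeneity. It is
    nonincreasing in r, and its limit for large r is the one-sided derivative s'(h; f). *)
Definition difference_quotient s h (r : R) f :=
  s (fun y => r * h y + f y) - r * s h.

Definition directional_derivative s h f :=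
  limn (fun n => difference_quotient s h n%:R f).

Section derivative.
Context (s : (X -> R) -> R) (h : X -> R) (ss : sublinear s) (Vh : V h).
Local Notation a := (difference_quotient s h).
Local Notation D := (directional_derivative s h).

Lemma difference_quotient_le (r r' : R) f : V f -> r <= r' -> a r' f <= a r f.
Proof.
move=> Vf rr'; rewrite /a lerBlDr.
have -> : (fun y => r' * h y + f y) =
    (fun y => (r * h y + f y) + (r' - r) * h y) by apply/funext => y; ring.
apply: le_trans (ss.1 _ _ (LpD (LpZ r Vh) Vf) (LpZ (r' - r) Vh)) _.
rewrite ss.2 ?subr_ge0//; lra.
Qed.

Lemma difference_quotient_ge r f : V f -> 0 <= r -> - s (fun y => - f y) <= a r f.
Proof.
move=> Vf r0; rewrite /a -ss.2// lerBrDr addrC lerBlDr.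
apply: le_trans (ss.1 _ _ (LpD (LpZ r Vh) Vf) (LpN Vf)).
by under [X in _ <= s X]eq_fun do rewrite addrK.
Qed.

Lemma difference_quotient_cvg f : V f -> a n%:R f @[n --> \oo] --> D f.
Proof.
move=> Vf; apply: nonincreasing_is_cvgn.
  by move=> m n mn; apply: difference_quotient_le => //; rewrite ler_nat.
exists (- s (fun y => - f y)) => _ [n _ <-].
exact: difference_quotient_ge.
Qed.

Lemma directional_derivative_le r f : V f -> 0 <= r -> D f <= a r f.
Proof.
move=> Vf r0.
apply: le_trans (@difference_quotient_le r (Num.truncn r).+1%:R _ Vf _); last first.
  exact/ltW/truncnS_gt.
apply: (nonincreasing_cvgn_ge _ (difference_quotient_cvg Vf)).
by move=> m n mn; apply: difference_quotient_le => //; rewrite ler_nat.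
Qed.

Lemma directional_derivative_ge c f : V f ->
  (forall n, c <= a n%:R f) -> c <= D f.
Proof.
move=> Vf ca; apply: limr_ge; first exact: difference_quotient_cvg Vf.
by near=> n; exact: ca.
Unshelve. all: by end_near. Qed.

Lemma directional_derivative_sub f : V f -> D f <= s f.
Proof.
move=> Vf; apply: le_trans (directional_derivative_le Vf (lexx 0)) _.
by rewrite /a mul0r subr0; under [X in s X]eq_fun do rewrite mul0r add0r.
Qed.

Lemma directional_derivativeD f g : V f -> V g ->
  D (fun y => f y + g y) <= D f + D g.
Proof.
move=> Vf Vg.
(* The quotient of f + g is taken at 2n, where it splits into the quotients of f and of g at n. *)
have aD n : D (fun y => f y + g y) <= a n%:R f + a n%:R g.
  have n20 : 0 <= n%:R + n%:R :> R by rewrite addr_ge0.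
  apply: le_trans (directional_derivative_le (LpD Vf Vg) n20) _.
  have -> : a (n%:R + n%:R) (fun y => f y + g y) =
      s (fun y => (n%:R * h y + f y) + (n%:R * h y + g y)) - (n%:R * s h + n%:R * s h).
    rewrite /a mulrDl; congr (s _ - _); apply/funext => y; ring.
  rewrite /a opprD addrACA lerD2r.
  by apply: ss.1; apply: LpD => //; exact: LpZ.
have cD : a n%:R f + a n%:R g @[n --> \oo] --> D f + D g.
  by apply: cvgD; exact: difference_quotient_cvg.
rewrite -(cvg_lim _ cD)//; apply: limr_ge; first by apply: cvgP cD.
by near=> n; exact: aD.
Unshelve. all: by end_near. Qed.

Lemma directional_derivativeZ b f : 0 <= b -> V f ->
  D (fun y => b * f y) = b * D f.
Proof.
have D0 : D (fun=> 0) = 0.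
  apply/eqP; rewrite eq_le; apply/andP; split.
    by rewrite -[leRHS](sublinear0 ss); apply/directional_derivative_sub/Lp_cst.
  apply: directional_derivative_ge => [|n]; first exact: Lp_cst.
  by rewrite /a; under eq_fun do rewrite addr0; rewrite ss.2// subrr.
(* Pulling out c turns the parameter n into n / c, which need not be an integer. One inequality
   suffices, since the other is the same one for 1 / b. *)
have bD c g : 0 < c -> V g -> c * D g <= D (fun y => c * g y).
  move=> c0 Vg; apply: directional_derivative_ge; first exact: LpZ.
  move=> n.
  have -> : a n%:R (fun y => c * g y) = c * a (n%:R / c) g.
    rewrite /a mulrBr -(ss.2 c (fun y => n%:R / c * h y + g y) (ltW c0)); last first.
      by apply: LpD => //; exact: LpZ.
    have cc z : c * (n%:R / c * z) = n%:R * z.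
      by rewrite mulrA [c * _]mulrC mulfVK ?gt_eqF.
    by rewrite cc; congr (s _ - _); apply/funext => y; rewrite mulrDr cc.
  rewrite (ler_pM2l c0); apply: directional_derivative_le => //.
  by rewrite divr_ge0// ltW.
rewrite le_eqVlt => /predU1P[<- Vf|b0 Vf].
  by under eq_fun do rewrite mul0r; rewrite mul0r.
apply/eqP; rewrite eq_le bD// andbT.
have b1 : 0 < b^-1 by rewrite invr_gt0.
have := bD _ _ b1 (LpZ b Vf); rewrite ler_pdivrMl//.
have -> // : (fun y => b^-1 * (b * f y)) = f.
by apply/funext => y; rewrite mulKf ?gt_eqF.
Qed.

Lemma directional_derivative_sublinear : sublinear D.
Proof.
by split=> *; [exact: directional_derivativeD|exact: directional_derivativeZ].
Qed.

(** At r = 1 the quotient is s 0 - s h. Together with - D (- h) <= D h <= s h this forces equality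
    throughout: the derivative keeps the value at h and is odd along h. *)
Lemma directional_derivative_opp : D (fun y => - h y) <= - s h.
Proof.
apply: le_trans (directional_derivative_le (LpN Vh) ler01) _.
rewrite /a mul1r; under eq_fun do rewrite mul1r subrr.
by rewrite (sublinear0 ss) sub0r.
Qed.

End derivative.

(** The linear functionals below s'(h; .) are exactly those below s that agree with s at h.
    Iteration therefore maximizes at h_0, then among the maximizers at h_1, and so on, in
    lexicographic order. *)
Fixpoint iterated_derivative s (h_ : nat -> X -> R) k : (X -> R) -> R :=
  if k is k'.+1 then directional_derivative (iterated_derivative s h_ k') (h_ k')
  else s.

Definition lexicographic_derivative s (h_ : nat -> X -> R) f :=
  limn (fun k => iterated_derivative s h_ k f).

Section lexicographic.
Context (s : (X -> R) -> R) (h_ : nat -> X -> R).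
Context (ss : sublinear s) (Vh : forall k, V (h_ k)).
Local Notation D_ := (iterated_derivative s h_).
Local Notation L := (lexicographic_derivative s h_).

Lemma iterated_derivative_sublinear k : sublinear (D_ k).
Proof. by elim: k => //= k IH; exact: directional_derivative_sublinear. Qed.

Lemma iterated_derivative_nonincreasing f : V f ->
  nonincreasing_seq (fun k => D_ k f).
Proof.
move=> Vf; apply/nonincreasing_seqP => k /=.
by apply: directional_derivative_sub => //; exact: iterated_derivative_sublinear.
Qed.

Lemma iterated_derivative_ge f k n : V f -> - D_ n (fun y => - f y) <= D_ k f.
Proof.
move=> Vf; have [kn|/ltnW nk] := leqP k n.
  apply: le_trans (sublinear_oppr (iterated_derivative_sublinear n) Vf) _.
  exact: iterated_derivative_nonincreasing.
apply: le_trans (sublinear_oppr (iterated_derivative_sublinear k) Vf).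
by rewrite lerN2; apply: iterated_derivative_nonincreasing => //; exact: LpN.
Qed.

Lemma lexicographic_derivative_cvg f : V f -> D_ k f @[k --> \oo] --> L f.
Proof.
move=> Vf; apply: nonincreasing_is_cvgn.
  exact: iterated_derivative_nonincreasing.
exists (- s (fun y => - f y)) => _ [n _ <-].
exact: (@iterated_derivative_ge _ _ 0).
Qed.

Lemma lexicographic_derivative_le k f : V f -> L f <= D_ k f.
Proof.
move=> Vf; apply: (nonincreasing_cvgn_ge _ (lexicographic_derivative_cvg Vf)).
exact: iterated_derivative_nonincreasing.
Qed.

Lemma lexicographic_derivative_sublinear : sublinear L.
Proof.
split=> [f g Vf Vg|b f b0 Vf].
  have cD : D_ k f + D_ k g @[k --> \oo] --> L f + L g.
    by apply: cvgD; exact: lexicographic_derivative_cvg.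
  rewrite -(cvg_lim _ cD)//; apply: limr_ge; first exact: cvgP cD.
  near=> n; apply: le_trans (lexicographic_derivative_le n (LpD Vf Vg)) _.
  exact: (iterated_derivative_sublinear n).1.
apply/(@cvg_lim R) => //.
under eq_fun do rewrite (iterated_derivative_sublinear _).2//.
by apply: cvgM; [exact: cvg_cst|exact: lexicographic_derivative_cvg].
Unshelve. all: by end_near. Qed.

(** Every later derivative at [h_ k] is squeezed between - D_(k+1) (- h_k) and D_k h_k, and these
    bounds meet because the derivative along [h_ k] is odd there. *)
Lemma lexicographic_derivative_stationary k : L (h_ k) = D_ k (h_ k).
Proof.
apply/eqP; rewrite eq_le lexicographic_derivative_le//=.
apply: limr_ge; first exact: lexicographic_derivative_cvg.
near=> n; apply: le_trans (@iterated_derivative_ge (h_ k) n k.+1 (Vh k)).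
rewrite lerNr /=; apply: directional_derivative_opp => //.
exact: iterated_derivative_sublinear.
Unshelve. all: by end_near. Qed.

Lemma lexicographic_derivative_first : L (h_ 0%N) = s (h_ 0%N).
Proof. exact: lexicographic_derivative_stationary. Qed.

Lemma lexicographic_derivative_opp k : L (fun y => - h_ k y) = - L (h_ k).
Proof.
apply/eqP; rewrite eq_le; apply/andP; split.
  apply: le_trans (lexicographic_derivative_le k.+1 (LpN (Vh k))) _.
  rewrite lexicographic_derivative_stationary /=.
  by apply: directional_derivative_opp => //; exact: iterated_derivative_sublinear.
have := sublinear_oppr lexicographic_derivative_sublinear (LpN (Vh k)).
by under eq_fun do rewrite opprK.
Qed.

End lexicographic.
End lexicographic_subgradient.

Lemma coherent_norm_cvg0 rho (coh : coherent P0 p rho) (f_ : nat -> X -> R) :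
  (forall n, V (f_ n)) -> Np (f_ n) @[n --> \oo] --> 0%E ->
  rho (fun y => `|f_ n y|) @[n --> \oo] --> 0.
Proof.
move=> Vf Nf; apply/cvgrPdist_le => e e0.
have [dl dl0 H] := coherent_cont coh e0.
have : \forall n \near \oo, (Np (f_ n) < dl%:E)%E.
  have /fine_cvgP[ffin fcvg] := Nf.
  move/cvgrPdist_lt : fcvg => /(_ dl dl0) fdl.
  near=> n; rewrite -[X in (X < _)%E]fineK; last by near: n.
  rewrite lte_fin; have : `|0 - fine (Np (f_ n))| < dl by near: n.
  by rewrite sub0r normrN => /ltr_normlP[].
apply: filterS => n Nn; rewrite sub0r normrN ger0_norm; first exact/H/ltW.
rewrite -(coherent0 coh); apply: coherent_le => //; [exact: Lp_cst|exact: Lp_norm].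
Unshelve. all: by end_near. Qed.

Lemma coherent_cvg rho (coh : coherent P0 p rho) (f_ : nat -> X -> R) f :
  (forall n, V (f_ n)) -> V f -> Np (fun y => f_ n y - f y) @[n --> \oo] --> 0%E ->
  rho (f_ n) @[n --> \oo] --> rho f.
Proof.
move=> Vf_ Vf Nf.
have /(coherent_norm_cvg0 coh)/(_ Nf) H : forall n, V (fun y => f_ n y - f y).
  by move=> n; exact: LpB.
apply/cvgrPdist_le => e e0; move/cvgrPdist_le : H => /(_ e e0).
apply: filterS => n; rewrite sub0r normrN => /(le_trans (ler_norm _)).
by apply: le_trans; rewrite distrC; exact: coherent_dist.
Qed.

(** * Functionals dominated by a coherent risk measure *)

Section positive_functional.
Context (rho L : (X -> R) -> R) (coh : coherent P0 p rho).
Context (Ls : sublinear_on L) (Lrho : forall f, V f -> L f <= rho f).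
Context (LN : forall f, V f -> L (fun y => - f y) = - L f).

Let L0 : L (fun=> 0) = 0. Proof. exact: sublinear0. Qed.

Lemma functionalD f g : V f -> V g -> L (fun y => f y + g y) = L f + L g.
Proof.
move=> Vf Vg; apply/eqP; rewrite eq_le Ls.1//=.
have := Ls.1 _ _ (LpN Vf) (LpN Vg); rewrite !LN//.
under eq_fun do rewrite -opprD.
by rewrite (LN (LpD Vf Vg)) -opprD lerN2.
Qed.

Lemma functionalZ a f : V f -> L (fun y => a * f y) = a * L f.
Proof.
move=> Vf; have [a0|a0] := leP 0 a; first exact: Ls.2.
have := Ls.2 (- a) f; rewrite oppr_ge0 => /(_ (ltW a0) Vf).
under eq_fun do rewrite mulNr.
by rewrite (LN (LpZ a Vf)) mulNr => /oppr_inj.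
Qed.

Lemma functional_sum (I : Type) (r : seq I) (c : I -> R) (F : I -> X -> R) :
  (forall i, V (F i)) -> V (fun y => \sum_(i <- r) c i * F i y) /\
  L (fun y => \sum_(i <- r) c i * F i y) = \sum_(i <- r) c i * L (F i).
Proof.
move=> VF; elim: r => [|i r [IHV IHL]].
  rewrite big_nil; under eq_fun do rewrite big_nil.
  by split; [exact: Lp_cst|exact: L0].
rewrite big_cons; under eq_fun do rewrite big_cons.
split; first by apply: LpD => //; exact: LpZ.
by rewrite functionalD ?functionalZ ?IHL//; exact: LpZ.
Qed.

Lemma functional_ae_le f g : V f -> V g -> ae_le f g -> L f <= L g.
Proof.
move=> Vf Vg fg; rewrite -subr_le0 -LN// -functionalD//; last exact: LpN.
apply: le_trans (Lrho (LpB Vf Vg)) _; rewrite -(coherent0 coh).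
apply: coherent_ae_le => //; [exact: LpB|exact: Lp_cst|].
by apply: filterS fg => y; rewrite subr_le0.
Qed.

Lemma functional_le f g : V f -> V g -> (forall y, f y <= g y) -> L f <= L g.
Proof. by move=> Vf Vg fg; apply: functional_ae_le => //; apply: aeW => y; exact: fg. Qed.

Lemma functional_ge0 f : V f -> (forall y, 0 <= f y) -> 0 <= L f.
Proof. by move=> Vf f0; rewrite -L0; apply: functional_le => //; exact: Lp_cst. Qed.

Lemma functional_norm f : V f -> `|L f| <= rho (fun y => `|f y|).
Proof.
move=> Vf; have Vn := Lp_norm Vf; apply: le_trans (Lrho Vn).
rewrite ler_norml lerNl -LN//; apply/andP; split; apply: functional_le => //.
- exact: LpN.
- by move=> y; rewrite -normrN ler_norm.
- by move=> y; rewrite ler_norm.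
Qed.

Lemma functional_cvg (f_ : nat -> X -> R) f :
  (forall n, V (f_ n)) -> V f -> Np (fun y => f_ n y - f y) @[n --> \oo] --> 0%E ->
  L (f_ n) @[n --> \oo] --> L f.
Proof.
move=> Vf_ Vf Nf.
have VB n : V (fun y => f_ n y - f y) by exact: LpB.
have H := coherent_norm_cvg0 coh VB Nf.
apply/cvgrPdist_le => e e0; move/cvgrPdist_le : H => /(_ e e0).
apply: filterS => n; rewrite sub0r normrN => /(le_trans (ler_norm _)).
apply: le_trans; rewrite distrC -LN// -functionalD//; last exact: LpN.
exact: functional_norm.
Qed.

(* The absolute value only matters for non-measurable B, when \1_B is not in L_p. *)
Definition functional_measure (B : set X) : \bar R := `|L \1_B|%:E.
Local Notation mu := functional_measure.

Lemma functional_measureE B : measurable B -> mu B = (L \1_B)%:E.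
Proof.
move=> mB; rewrite /mu ger0_norm// functional_ge0//; first exact: Lp_indic.
Qed.

Let mu0 : mu set0 = 0%E.
Proof. by rewrite functional_measureE// indic0 L0. Qed.

Let mu_ge0 B : (0 <= mu B)%E. Proof. by rewrite lee_fin. Qed.

(** Countable additivity is continuity of [L] along the partial sums of the indicators, which
    converge in L_p because they are bounded by 1. *)
Let mu_sigma_additive : semi_sigma_additive mu.
Proof.
move=> F mF tF mUF.
have VF i : V \1_(F i) by exact: Lp_indic.
pose S n y : R := \sum_(i <- index_iota 0 n) 1 * \1_(F i) y.
have HS n := @functional_sum _ (index_iota 0 n) (fun=> 1) _ VF.
have S1 y n : S n y <= \1_(\bigcup_i F i) y.
  rewrite -lee_fin indic_bigcup// /S -sumEFin.
  under eq_bigr do rewrite mul1r.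
  by apply: nneseries_lim_ge => i _ _; rewrite lee_fin.
have S0 y n : 0 <= S n y by apply: sumr_ge0 => i _; rewrite mul1r.
have -> : (fun n => \sum_(0 <= i < n) mu (F i))%E = (fun n => (L (S n))%:E).
  apply/funext => n; rewrite (HS n).2 -sumEFin; apply: eq_bigr => i _.
  by rewrite mul1r functional_measureE.
rewrite functional_measureE//; apply: cvg_EFin; first by near=> n.
apply: functional_cvg => [n||]; [exact: (HS n).1|exact: Lp_indic|].
apply: (Np_cvg0 (Lp_cst 1)) => [n|n y|y].
- by apply: measurable_funB; [exact: Lp_measurable (HS n).1|exact: measurable_indic].
- rewrite distrC ger0_norm ?subr_ge0//.
  apply: (@le_trans _ _ (\1_(\bigcup_i F i) y)); first by rewrite gerBl.
  by rewrite indicE; case: (_ \in _).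
- rewrite -(subrr (\1_(\bigcup_i F i) y)); apply: cvgB; last exact: cvg_cst.
  suff /fine_cvg : (S n y)%:E @[n --> \oo] --> (\1_(\bigcup_i F i) y)%:E by [].
  rewrite indic_bigcup//.
  rewrite (_ : (fun n => (S n y)%:E) = eseries (fun i => (\1_(F i) y)%:E)).
    exact: is_cvg_nneseries.
  apply/funext => n; rewrite /eseries/= /S -sumEFin.
  by apply: eq_bigr => i _; rewrite mul1r.
Unshelve. all: by end_near. Qed.

HB.instance Definition _ := isMeasure.Build _ _ _ mu mu0 mu_ge0 mu_sigma_additive.

(** Translation equivariance gives [rho] the value a at each constant a; the constants 1 and -1
    bound L 1 from both sides. *)
Let mu1 : mu setT = 1%E.
Proof.
rewrite functional_measureE// indicT; congr EFin; apply/eqP; rewrite eq_le.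
have V1 := Lp_cst 1; have rc a : rho (cst a) = a.
  by have := coherent_cst coh a (Lp_cst 0); rewrite (coherent0 coh) !addr0.
apply/andP; split; first by rewrite -[leRHS]rc; exact: Lrho.
by have := Lrho (Lp_cst (-1)); rewrite [leRHS](rc (-1)) (LN V1) lerN2.
Qed.

HB.instance Definition _ := Measure_isProbability.Build _ _ _ mu mu1.

Import HBNNSimple.

Lemma integral_functional_measure f : V f -> (forall y, 0 <= f y) ->
  (\int[mu]_y (f y)%:E)%E = (L f)%:E.
Proof.
move=> Vf f0; have mf : measurable_fun setT (EFin \o f).
  exact/measurable_EFinP/Lp_measurable.
pose f_ := nnsfun_approx measurableT mf.
have f_f y : f_ n y @[n --> \oo] --> f y.
  have : (EFin \o (fun n => f_ n y)) @ \oo --> (f y)%:E.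
    by apply: cvg_nnsfun_approx => // z _; rewrite lee_fin.
  exact: fine_cvg.
have fle n y : f_ n y <= f y.
  rewrite -(cvg_lim _ (f_f y))//; apply: (nondecreasing_cvgn_le _ (cvgP _ (f_f y))).
  by move=> a b ab; exact/lefP/nd_nnsfun_approx.
have simple n : V (f_ n) /\ (\int[mu]_y (f_ n y)%:E)%E = (L (f_ n))%:E.
  rewrite integralT_nnsfun sintegralE.
  pose rg : seq R := finmap.enum_fset (fset_set (range (f_ n))).
  have fE : (f_ n : X -> R) = (fun y => \sum_(r <- rg) r * \1_(f_ n @^-1` [set r]) y).
    by apply/funext => y; rewrite [LHS]fimfunE fsbig_finite.
  have VI r : V \1_(f_ n @^-1` [set r]) by exact: Lp_indic.
  have [VS LS] := functional_sum rg id VI.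
  rewrite [X in V X]fE [X in L X]fE; split; first exact: VS.
  rewrite LS -sumEFin fsbig_finite//=; apply: eq_bigr => r _.
  by rewrite functional_measureE.
have cL : L (f_ n) @[n --> \oo] --> L f.
  apply: functional_cvg => [n||]; [exact: (simple n).1|exact: Vf|].
  apply: (Np_cvg0 Vf) => [n|n y|y].
  - by apply: measurable_funB; [exact: Lp_measurable (simple n).1|exact: Lp_measurable].
  - by rewrite distrC ger0_norm ?subr_ge0// gerBl.
  - by rewrite -(subrr (f y)); apply: cvgB => //; exact: cvg_cst.
have cI : (\int[mu]_y (f_ n y)%:E)%E @[n --> \oo] --> (\int[mu]_y (f y)%:E)%E.
  have -> : (\int[mu]_y (f y)%:E)%E =
      (\int[mu]_y limn (fun n => (f_ n y)%:E))%E.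
    apply: eq_integral => y _; apply/esym/cvg_lim => //.
    by apply: cvg_EFin; [near=> n|exact: f_f].
  apply: cvg_monotone_convergence => //.
  - by move=> n; apply/measurable_EFinP; exact: Lp_measurable (simple n).1.
  - by move=> n y _; rewrite lee_fin.
  - by move=> y _ m n mn; rewrite lee_fin; exact/lefP/nd_nnsfun_approx.
apply: (cvg_unique _ cI) => //=.
rewrite (_ : (fun n => _) = (fun n => (L (f_ n))%:E)); last first.
  by apply/funext => n; exact: (simple n).2.
by apply: cvg_EFin => //; near=> n.
Unshelve. all: by end_near. Qed.

Lemma pairing_functional_measure f : V f -> pairing f mu = L f.
Proof.
move=> Vf; rewrite /pairing /Rintegral integralE.
pose fp y := Num.max (f y) 0; pose fn y := Num.max (- f y) 0.
have mf := Lp_measurable Vf.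
have Vp : V fp.
  apply: (Lp_le _ Vf); first exact: measurable_maxr.
  by move=> y; rewrite /fp; case: (leP (f y) 0) => _; rewrite ?normr0 ?lexx.
have Vn : V fn.
  apply: (Lp_le _ Vf); first by apply: measurable_maxr => //; exact: measurableT_comp.
  by move=> y; rewrite /fn; case: (leP (- f y) 0) => _; rewrite ?normr0 ?normrN ?lexx.
have -> : (\int[mu]_y (EFin \o f)^\+ y = (L fp)%:E)%E.
  rewrite -integral_functional_measure//; last by move=> y; rewrite le_max lexx orbT.
  by apply: eq_integral => y _; rewrite funeposE EFin_max.
have -> : (\int[mu]_y (EFin \o f)^\- y = (L fn)%:E)%E.
  rewrite -integral_functional_measure//; last by move=> y; rewrite le_max lexx orbT.
  by apply: eq_integral => y _; rewrite funenegE EFin_max.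
rewrite -EFinB /= -LN// -functionalD//; last exact: LpN.
congr L; apply/funext => y; rewrite /fp /fn.
by case: (leP (f y) 0) => h; case: (leP (- f y) 0) => h'; lra.
Qed.

Lemma functional_measure_dominates : mu `<< P0.
Proof.
apply/null_content_dominatesP => B mB PB0; rewrite functional_measureE//.
congr EFin; apply/eqP; rewrite eq_le functional_ge0//; last exact: Lp_indic.
rewrite andbT -L0; apply: functional_ae_le; [exact: Lp_indic|exact: Lp_cst|].
exists B; split => // y /= /negP; rewrite indicE -ltNge.
by case: (boolP (y \in B)) => [/set_mem//|_]; rewrite ltxx.
Qed.

Let h := Radon_Nikodym_SigmaFinite.f mu P0.
Let g y := fine (h y).

Let g_ge0 y : 0 <= g y.
Proof. exact/fine_ge0/Radon_Nikodym_SigmaFinite.f_ge0/functional_measure_dominates. Qed.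

Let gE y : (g y)%:E = h y.
Proof.
by rewrite fineK//; exact/Radon_Nikodym_SigmaFinite.f_fin_num/functional_measure_dominates.
Qed.

Let mg : measurable_fun setT g.
Proof.
apply: (measurableT_comp (fine_measurable measurableT)).
apply: measurable_int; apply: Radon_Nikodym_SigmaFinite.f_integrable.
exact: functional_measure_dominates.
Qed.

Let integral_density f : V f -> (forall y, 0 <= f y) ->
  (\int[P0]_y (f y * g y)%:E)%E = (L f)%:E.
Proof.
move=> Vf f0; rewrite -integral_functional_measure//.
rewrite -(Radon_Nikodym_SigmaFinite.change_of_variables functional_measure_dominates)//.
- by apply: eq_integral => y _; rewrite EFinM gE.
- exact/measurable_EFinP/Lp_measurable.
Qed.

(** This plays the part of a finite dual norm of [L]; the integrability of the density is read off
    from it by suitable test functions. *)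
Let density_bound : exists2 dl, 0 < dl & forall f, V f -> (forall y, 0 <= f y) ->
  (Np f <= dl%:E)%E -> (\int[P0]_y (f y * g y)%:E <= 1%:E)%E.
Proof.
have [dl dl0 H] := coherent_cont coh ltr01.
exists dl => // f Vf f0 Nf; rewrite integral_density// lee_fin.
exact: le_trans (ler_norm _) (le_trans (functional_norm Vf) (H _ Vf Nf)).
Qed.

Let density_Linfty : p = 1 -> g \in Lfun P0 +oo%E.
Proof.
move=> p1; have [dl dl0 H] := density_bound.
rewrite inE; apply/andP; split; rewrite inE//= /finite_norm unlock /Lnorm.
case: ifP => _ //.
apply: (@le_lt_trans _ _ (2 / dl)%:E); last exact: ltry.
pose B := [set y | 2 / dl < g y].
have mB : measurable B.
  by rewrite -[B]setTI; exact: measurable_fun_ltr.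
apply/ess_sup_inf.ess_supP; exists B; split => //; last first.
  move=> y /= /negP; rewrite lee_fin ger0_norm// -ltNge; exact.
have [//|B0] := eqVneq (P0 B) 0%E.
have PB0 : 0 < fine (P0 B).
  by rewrite fine_gt0// lt0e B0 measure_ge0/= ltey_eq fin_num_measure.
(* Scaled so that [Np] of s \1_B equals dl. As g > 2 / dl on B, its integral against g would be at
   least 2, above the bound 1. *)
pose s := dl / fine (P0 B).
have s0 : 0 <= s by rewrite divr_ge0// ltW.
have D0 : 0 <= 2 / dl by rewrite divr_ge0// ltW.
have Ds0 : 0 <= 2 / dl * s by exact: mulr_ge0.
have Vs : V (fun y => s * \1_B y) by exact/LpZ/Lp_indic.
have sB : (s%:E * P0 B = dl%:E)%E.
  by rewrite -[P0 B]fineK ?fin_num_measure// -EFinM divfK// gt_eqF.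
have : (\int[P0]_y (s * \1_B y * g y)%:E <= 1%:E)%E.
  apply: H => //; first by move=> y; rewrite mulr_ge0.
  rewrite NpZ; last exact: measurable_indic.
  by rewrite Np_indic// p1 powRr1// ger0_norm// sB.
have : ((2 / dl)%:E * (s%:E * P0 B) <= \int[P0]_y (s * \1_B y * g y)%:E)%E.
  rewrite muleA -EFinM -[B in P0 B]setIT -integral_indic// -ge0_integralZl//.
  - apply: ge0_le_integral => //.
    + by move=> y _; rewrite -EFinM lee_fin mulr_ge0.
    + by apply/measurable_EFinP; apply: measurable_funM => //; exact: measurable_indic.
    + apply/measurable_EFinP; apply: measurable_funM => //.
      exact: Lp_measurable Vs.
    + move=> y _; rewrite -EFinM lee_fin indicE.
      case: (boolP (y \in B)) => [/set_mem/ltW By|_]; last by rewrite !mulr0 mul0r.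
      by rewrite !mulr1 mulrC ler_wpM2l.
  - by apply/measurable_EFinP; exact: measurable_indic.
rewrite sB => /le_trans/[apply]; rewrite -EFinM divfK ?gt_eqF// lee_fin.
by rewrite leNgt ltr1n.
Qed.

(* The functional is tested against the truncations of g ^ (q - 1). *)
Let density_Lq : 1 < p -> g \in Lfun P0 (p / (p - 1))%:E.
Proof.
move=> p1; have [dl dl0 H] := density_bound.
set q := p / (p - 1).
have r0 : 0 < p - 1 by rewrite subr_gt0.
have q0 : 0 < q by rewrite divr_gt0.
have q1p : (q - 1) * p = q.
  by rewrite /q; field; rewrite gt_eqF.
pose G n y := Num.min (g y) n%:R.
have G0 n y : 0 <= G n y by rewrite le_min g_ge0 ler0n.
have mG n : measurable_fun setT (G n) by exact: measurable_minr.
have mGq n e : measurable_fun setT (fun y => G n y `^ e).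
  exact: (measurableT_comp (measurable_powR e)).
have Gn n y e : 0 <= e -> G n y `^ e <= n%:R `^ e.
  by move=> e0; apply: ge0_ler_powR => //; rewrite ?nnegrE// ge_min lexx orbT.
pose I n := fine (\int[P0]_y (G n y `^ q)%:E)%E.
have I0 n : 0 <= I n by apply/fine_ge0/integral_ge0 => y _; rewrite lee_fin powR_ge0.
have IE n : (\int[P0]_y (G n y `^ q)%:E)%E = (I n)%:E.
  rewrite fineK// ge0_fin_numE; last by apply: integral_ge0 => y _; rewrite lee_fin powR_ge0.
  apply: (@le_lt_trans _ _ (\int[P0]_y (cst (n%:R `^ q)%:E y))%E).
    apply: ge0_le_integral => //.
    - by move=> y _; rewrite lee_fin powR_ge0.
    - exact/measurable_EFinP.
    - by move=> y _; rewrite lee_fin Gn// ltW.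
  by rewrite integral_cst// (_ : _ [set: X] = 1%E) ?mule1 ?ltry//; exact: probability_setT.
have IB n : I n <= (dl^-1) `^ (p - 1)^-1.
  have := I0 n; rewrite le_eqVlt => /predU1P[<-|In]; first exact: powR_ge0.
  (* Normalizes the test function c G^(q-1) to [Np] equal to dl, since (q - 1) p = q. As G <= g, the
     bound gives c I <= 1, that is dl I^(p-1) <= 1, uniformly in n. *)
  pose c := (dl / I n) `^ p^-1.
  have c0 : 0 <= c by exact: powR_ge0.
  have cp : c `^ p = dl / I n by rewrite -powRrM mulVf// powRr1// divr_ge0// ltW.
  have q10 : 0 <= q - 1 by rewrite -(pmulr_lge0 _ p_gt0) q1p ltW.
  have Vf : V (fun y => c * G n y `^ (q - 1)).
    apply: LpZ; apply: (Lp_le (mGq n _) (Lp_cst (n%:R `^ (q - 1)))) => y.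
    by rewrite !ger0_norm ?powR_ge0// Gn.
  have cI : c * I n <= 1.
    rewrite -lee_fin; apply: le_trans (H _ Vf _ _).
    - have -> : (c * I n)%:E = (\int[P0]_y (c * G n y `^ q)%:E)%E.
        rewrite EFinM -IE -ge0_integralZl//; first exact/measurable_EFinP.
        by move=> y _; rewrite lee_fin powR_ge0.
      apply: ge0_le_integral => //.
      + by move=> y _; rewrite lee_fin mulr_ge0// powR_ge0.
      + by apply/measurable_EFinP; apply: measurable_funM.
      + by apply/measurable_EFinP; apply: measurable_funM => //; exact: Lp_measurable Vf.
      + move=> y _; rewrite lee_fin -mulrA ler_wpM2l//.
        rewrite -mulr_powRB1// mulrC ler_wpM2l ?powR_ge0//.
        by rewrite ge_min lexx.
    - by move=> y; rewrite mulr_ge0// powR_ge0.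
    - rewrite NpZ//.
      have -> : Np (fun y => G n y `^ (q - 1)) = (I n)%:E.
        rewrite -IE; apply: eq_integral => y _.
        by rewrite ger0_norm ?powR_ge0// -powRrM q1p.
      by rewrite ger0_norm// cp -EFinM divfK// gt_eqF.
  have : (c * I n) `^ p <= 1.
    rewrite (_ : 1 = 1 `^ p); last by rewrite powR1.
    by apply: ge0_ler_powR => //; rewrite nnegrE ?mulr_ge0.
  rewrite powRM// cp -mulr_powRB1// mulrA divfK ?gt_eqF// => dI.
  have : I n `^ (p - 1) <= dl^-1 by rewrite -[leRHS]mul1r ler_pdivlMr// mulrC.
  move/(@ge0_ler_powR _ (p - 1)^-1) => HI.
  have <- : (I n `^ (p - 1)) `^ (p - 1)^-1 = I n.
    by rewrite -powRrM mulfV ?gt_eqF// powRr1.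
  by apply: HI; rewrite ?nnegrE ?invr_ge0 ?powR_ge0// ltW.
rewrite inE; apply/andP; split; rewrite inE//= /finite_norm unlock /Lnorm.
rewrite poweR_lty//.
apply: (@le_lt_trans _ _ ((dl^-1) `^ (p - 1)^-1)%:E); last exact: ltry.
have -> : (\int[P0]_y `|(EFin \o g) y| `^ q =
    \int[P0]_y limn (fun n => (G n y `^ q)%:E))%E.
  apply: eq_integral => y _; rewrite /= ger0_norm//.
  apply/esym/cvg_lim => //; apply: cvg_near_cst.
  near=> n; congr (_ `^ _)%:E; rewrite /G; apply/min_idPl.
  by near: n; exact: nbhs_infty_ger.
rewrite monotone_convergence//.
- apply: lime_le; last by apply: nearW => n; rewrite IE lee_fin IB.
  apply: ereal_nondecreasing_is_cvgn => a b ab.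
  apply: ge0_le_integral => //.
  - by move=> y _; rewrite lee_fin powR_ge0.
  - exact/measurable_EFinP.
  - exact/measurable_EFinP.
  move=> y _; rewrite lee_fin ge0_ler_powR ?nnegrE ?(ltW q0)//.
  by rewrite /G le_min ge_min lexx/= ge_min ler_nat ab orbT.
- by move=> n; exact/measurable_EFinP.
- by move=> n y _; rewrite lee_fin powR_ge0.
- move=> y _ a b ab; rewrite lee_fin ge0_ler_powR ?nnegrE ?(ltW q0)//.
  by rewrite /G le_min ge_min lexx/= ge_min ler_nat ab orbT.
Unshelve. all: by end_near. Qed.

Lemma functional_measure_Mset : Mset P0 p mu.
Proof.
exists g; last first.
  move=> B mB; rewrite (Radon_Nikodym_SigmaFinite.f_integral functional_measure_dominates)//.
  by apply: eq_integral => y _; rewrite gE.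
rewrite /hoelder_conjugate/= eqe (negbTE p_neq0).
have [p1|p1] := eqVneq p 1.
  by rewrite -EFinB p1 subrr inve0 mul1e -[X in Lfun _ X]/(+oo%E); exact: density_Linfty.
have := density_Lq; rewrite lt_neqAle eq_sym p1 p_ge1 => /(_ isT).
rewrite -EFinB inver subr_eq0 (negbTE p1).
by rewrite -EFinM.
Qed.

Lemma functional_probability : exists mu : probability X R, [/\ Mset P0 p mu,
  forall f, V f -> pairing f mu = L f &
  forall B, measurable B -> mu B = (L \1_B)%:E].
Proof.
exists mu; split; [exact: functional_measure_Mset|exact: pairing_functional_measure|].
exact: functional_measureE.
Qed.

End positive_functional.

(** * A countable dense family in L_p *)

Section density.

Lemma Np_le_add f g (k : X -> R) (e1 e2 : R) : measurable_fun setT f -> measurable_fun setT g ->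
  measurable_fun setT k -> (Np (fun y => (f y - g y)%R) <= e1%:E)%E ->
  (Np (fun y => (g y - k y)%R) <= e2%:E)%E ->
  (Np (fun y => (f y - k y)%R) <= (2 `^ p * (e1 + e2))%:E)%E.
Proof.
move=> mf mg mk H1 H2.
have -> : (fun y => f y - k y) = (fun y => (f y - g y) + (g y - k y)).
  by apply/funext => y; rewrite addrA subrK.
apply: le_trans (Np_add _ _) _; [exact: measurable_funB|exact: measurable_funB|].
rewrite EFinM EFinD; apply: lee_wpmul2l; first by rewrite lee_fin powR_ge0.
exact: (leeD H1 H2).
Qed.

Let base := sval (cid (borel_countable_base X)).
Let base_open i : open (base i). Proof. exact: (svalP (cid (borel_countable_base X))).1. Qed.

(** Finite unions are used so that every open set is the limit of an increasing sequence of them. *)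
Let base_union (s : seq nat) := \bigcup_(i in [set` s]) base i.

Let measurable_base_union s : measurable (base_union s).
Proof.
by apply: open_measurable_borel; apply: bigcup_open => i _; exact: base_open.
Qed.

Let step_function (l : seq (rat * seq nat)) (y : X) : R :=
  \sum_(a <- l) ratr a.1 * \1_(base_union a.2) y.

(** Rational coefficients and finite lists of indices form a countable type, enumerated by
    [unpickle]; a number that decodes to nothing stands for the zero function. *)
Definition dense_family (n : nat) : X -> R :=
  if unpickle n is Some l then step_function l else fun=> 0.

Let Lp_step_function l : V (step_function l).
Proof.
elim: l => [|a l IH]; rewrite /step_function.
  by under eq_fun do rewrite big_nil; exact: Lp_cst.
under eq_fun do rewrite big_cons.
by apply: LpD => //; apply: LpZ; exact: Lp_indic.
Qed.

Lemma Lp_dense_family n : V (dense_family n).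
Proof. by rewrite /dense_family; case: unpickle => [l|]; [|exact: Lp_cst]. Qed.

Let approximable f := forall e : R, 0 < e ->
  exists l, (Np (fun y => (f y - step_function l y)%R) <= e%:E)%E.

Let half_eps (e : R) : 0 < e -> exists2 e' : R, 0 < e' & 2 `^ p * (e' + e') = e.
Proof.
move=> e0; exists (e / 2 / 2 `^ p); first by rewrite !divr_gt0// powR_gt0.
have : 2 `^ p != 0 :> R by rewrite gt_eqF// powR_gt0.
by move=> ?; field.
Qed.

Let approximable_closed f : measurable_fun setT f ->
  (forall e : R, 0 < e -> exists g, [/\ measurable_fun setT g, approximable g &
    (Np (fun y => (f y - g y)%R) <= e%:E)%E]) -> approximable f.
Proof.
move=> mf H e /half_eps[e' e0 <-]; have [g [mg ag fg]] := H _ e0.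
have [l gl] := ag _ e0; exists l.
exact: (Np_le_add mf mg (Lp_measurable (Lp_step_function l))).
Qed.

Let approximable_cvg f (f_ : nat -> X -> R) : measurable_fun setT f ->
  (forall n, measurable_fun setT (f_ n)) -> (forall n, approximable (f_ n)) ->
  Np (fun y => (f_ n y - f y)%R) @[n --> \oo] --> 0%E -> approximable f.
Proof.
move=> mf mf_ af_ Nf; apply: approximable_closed => // e e0.
have /fine_cvgP[ffin /cvgrPdist_le /(_ e e0) fe] := Nf.
have [n [fn ne]] : exists n, Np (fun y => (f_ n y - f y)%R) \is a fin_num /\
    `|0 - fine (Np (fun y => (f_ n y - f y)%R))| <= e.
  suff : \forall n \near \oo, Np (fun y => (f_ n y - f y)%R) \is a fin_num /\
    `|0 - fine (Np (fun y => (f_ n y - f y)%R))| <= e.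
    by case=> N _ /(_ N (leqnn N)) ?; exists N.
  by near=> n; split; near: n.
exists (f_ n); split => //; rewrite NpB -[X in (X <= _)%E]fineK// lee_fin.
by move: ne; rewrite sub0r normrN; exact/le_trans/ler_norm.
Unshelve. all: by end_near. Qed.

Let approximableD f g : measurable_fun setT f -> measurable_fun setT g ->
  approximable f -> approximable g -> approximable (fun y => f y + g y).
Proof.
move=> mf mg af ag e /half_eps[e' e0 <-].
have [l fl] := af _ e0; have [m gm] := ag _ e0; exists (l ++ m).
have ml := Lp_measurable (Lp_step_function l).
have mm := Lp_measurable (Lp_step_function m).
have -> : (fun y => f y + g y - step_function (l ++ m) y) =
    (fun y => (f y - step_function l y) + (g y - step_function m y)).
  by apply/funext => y; rewrite /step_function big_cat/= opprD addrACA.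
apply: le_trans (Np_add _ _) _; [exact: measurable_funB|exact: measurable_funB|].
rewrite EFinM EFinD; apply: lee_wpmul2l; first by rewrite lee_fin powR_ge0.
exact: (leeD fl gm).
Qed.

Let approximableZ a f : V f -> approximable f -> approximable (fun y => a * f y).
Proof.
move=> Vf af; have mf := Lp_measurable Vf.
have rat_approx (r : rat) : approximable (fun y => ratr r * f y).
  move=> e e0.
  pose c := `|ratr r| `^ p : R; have c0 : 0 <= c by exact: powR_ge0.
  have e'0 : 0 < e / (c + 1) by rewrite divr_gt0// ltr_wpDl.
  have [l fl] := af _ e'0; exists [seq (r * a.1, a.2) | a <- l].
  have -> : (fun y => ratr r * f y - step_function [seq (r * a.1, a.2) | a <- l] y) =
      (fun y => ratr r * (f y - step_function l y)).
    apply/funext => y; rewrite /step_function big_map mulrBr mulr_sumr.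
    rewrite (eq_bigr (fun i => ratr r * (ratr i.1 * \1_(base_union i.2) y)))// => i _ /=.
    by rewrite rmorphM mulrA.
  rewrite NpZ; last by apply: measurable_funB => //; exact: Lp_measurable.
  apply: (@le_trans _ _ (c%:E * (e / (c + 1))%:E)%E).
    by rewrite lee_wpmul2l// lee_fin.
  rewrite -EFinM lee_fin mulrA ler_pdivrMr ?ltr_wpDl//.
  by rewrite mulrC ler_pM2l// lerDl.
apply: approximable_closed => [|e e0]; first exact: measurable_funM.
have /LpP[_ Nf] := Vf.
pose N := fine (Np f); have NE : Np f = N%:E.
  by rewrite fineK// ge0_fin_numE// Np_ge0.
have N0 : 0 <= N by rewrite fine_ge0// Np_ge0.
(* Chosen so that dl^p times [Np f] is at most e; adding 1 covers the case N = 0. *)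
pose dl := (e / (N + 1)) `^ p^-1.
have dl0 : 0 < dl by rewrite powR_gt0// divr_gt0// ltr_wpDl.
have [r] : exists r : rat, ratr r \in `]a, a + dl[ by apply: rat_in_itvoo; rewrite ltrDl.
rewrite in_itv/= => /andP[ar ra].
exists (fun y => ratr r * f y); split; [exact: measurable_funM|exact: rat_approx|].
have -> : (fun y => a * f y - ratr r * f y) = (fun y => (a - ratr r) * f y).
  by apply/funext => y; rewrite mulrBl.
rewrite NpZ// NE -EFinM lee_fin.
apply: (@le_trans _ _ (dl `^ p * N)).
  rewrite ler_wpM2r// ge0_ler_powR ?nnegrE//; first exact: ltW.
  by rewrite distrC ger0_norm ?subr_ge0 1?ltW// ltrBlDl.
rewrite /dl -powRrM mulVf// powRr1; last by rewrite divr_ge0// ?ltW// ltr_wpDl.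
by rewrite mulrAC ler_pdivrMr ?ltr_wpDl// ler_pM2l// lerDl.
Qed.

Let approximable_base_union s : approximable \1_(base_union s).
Proof.
move=> e e0; exists [:: (1, s)].
under eq_fun do rewrite /step_function big_seq1 rmorph1 mul1r subrr.
rewrite /Np; under eq_integral do rewrite normr0 powR0//.
by rewrite integral0 lee_fin ltW.
Qed.

Let approximable_indic_ndseq (F : nat -> set X) :
  {homo F : n m / (n <= m)%N >-> (n <= m)%O} -> (forall n, measurable (F n)) ->
  (forall n, approximable \1_(F n)) -> approximable \1_(\bigcup_n F n).
Proof.
move=> ndF mF aF.
have mUF : measurable (\bigcup_n F n) by exact: bigcupT_measurable.
apply: (approximable_cvg (f_ := fun n => \1_(F n))) aF _;
  [exact: measurable_indic|by move=> n; exact: measurable_indic|].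
apply: (Np_cvg0 (Lp_cst 1)) => [n|n y|y].
- by apply: measurable_funB; exact: measurable_indic.
- rewrite distrC !indicE; case: (boolP (y \in F n)) => [yF|_].
    rewrite (_ : y \in \bigcup_n F n) ?subrr ?normr0//.
    by apply/mem_set; exists n => //; exact/set_mem.
  by rewrite subr0; case: (_ \in _); rewrite ?normr1 ?normr0.
- apply: cvg_near_cst; have [[N _ FN]|nF] := pselect ((\bigcup_n F n) y).
    near=> n; rewrite !indicE !mem_set ?subrr//; first by exists N.
    have Nn : (N <= n)%N by near: n; exact: nbhs_infty_ge.
    by have /subsetPset := ndF _ _ Nn; apply.
  near=> n; rewrite !indicE !memNset ?subrr// => Fy.
  by apply: nF; exists n.
Unshelve. all: by end_near. Qed.

Let approximable_indic_open O : open O -> approximable \1_O.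
Proof.
move=> oO; pose s n := [seq i <- iota 0 n | `[< base i `<=` O >]].
have -> : O = \bigcup_n base_union (s n).
  apply/seteqP; split=> [x Ox|x [n _ [i /=]]]; last first.
    by rewrite mem_filter => /andP[/asboolP + _]; exact.
  have [i bx bO] := (svalP (cid (borel_countable_base X))).2 x O oO Ox.
  exists i.+1 => //; exists i => //=; rewrite mem_filter mem_iota/= add0n ltnSn andbT.
  exact/asboolP.
apply: approximable_indic_ndseq => [m n mn|n|n].
- apply/subsetPset; apply: bigcup_subset => i /=.
  rewrite !mem_filter !mem_iota/= !add0n => /andP[-> im]/=.
  exact: leq_trans im mn.
- exact: measurable_base_union.
- exact: approximable_base_union.
Qed.

(** Open sets are stable under intersection and generate the Borel sets, and the sets with
    approximable indicator form a lambda-system. *)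
Let approximable_indic B : measurable B -> approximable \1_B.
Proof.
rewrite {1}(@borel_measurableE R d X) => sB.
suff [] : [set C | measurable C /\ approximable \1_C] B by [].
move: B sB; apply: (@lambda_system_subset _ _ (@openI X)); last 2 first.
- by move=> O oO; split; [exact: open_measurable_borel|exact: approximable_indic_open].
- by move=> ? _; exact: subsetT.
- split.
  + by move=> ? _; exact: subsetT.
  + by split; [exact: measurableT|apply: approximable_indic_open; exact: openT].
  + move=> A B BA [mA aA] [mB aB]; split; first exact: measurableD.
    have -> : \1_(A `\` B) = (fun y => \1_A y + -1 * \1_B y) :> (X -> R).
      apply/funext => y; rewrite !indicE in_setD mulN1r.
      case: (boolP (y \in B)) => [/set_mem/BA/mem_set ->|_]; first by rewrite subrr.
      by rewrite subr0; case: (_ \in _).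
    apply: approximableD; first exact: measurable_indic.
    - by apply: measurable_funM => //; exact: measurable_indic.
    - exact: aA.
    - by apply: approximableZ; [exact: Lp_indic|exact: aB].
  + move=> F ndF HF; split.
      by apply: bigcupT_measurable => n; exact: (HF n).1.
    by apply: (approximable_indic_ndseq ndF) => n; [exact: (HF n).1|exact: (HF n).2].
Qed.

Import HBNNSimple.

Let approximable_ge0 f : V f -> (forall y, 0 <= f y) -> approximable f.
Proof.
move=> Vf f0; have mf : measurable_fun setT (EFin \o f).
  exact/measurable_EFinP/Lp_measurable.
pose f_ := nnsfun_approx measurableT mf.
have f_f y : f_ n y @[n --> \oo] --> f y.
  have : (EFin \o (fun n => f_ n y)) @ \oo --> (f y)%:E.
    by apply: cvg_nnsfun_approx => // z _; rewrite lee_fin.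
  exact: fine_cvg.
have fle n y : f_ n y <= f y.
  rewrite -(cvg_lim _ (f_f y))//; apply: (nondecreasing_cvgn_le _ (cvgP _ (f_f y))).
  by move=> a b ab; exact/lefP/nd_nnsfun_approx.
have mf_ n : measurable_fun setT (f_ n) by [].
apply: (approximable_cvg (f_ := fun n => f_ n)); [exact: Lp_measurable|exact: mf_| |].
- move=> n; pose rg : seq R := finmap.enum_fset (fset_set (range (f_ n))).
  have -> : (f_ n : X -> R) = (fun y => \sum_(r <- rg) r * \1_(f_ n @^-1` [set r]) y).
    by apply/funext => y; rewrite [LHS]fimfunE fsbig_finite.
  have VI r : V \1_(f_ n @^-1` [set r]) by exact: Lp_indic.
  suff [] : V (fun y => \sum_(r <- rg) r * \1_(f_ n @^-1` [set r]) y) /\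
      approximable (fun y => \sum_(r <- rg) r * \1_(f_ n @^-1` [set r]) y) by [].
  elim: rg => [|r rg [IH1 IH2]].
    under eq_fun do rewrite big_nil; split; first exact: Lp_cst.
    move=> e e0; exists [::]; rewrite /step_function.
    under eq_fun do rewrite big_nil subrr.
    rewrite /Np; under eq_integral do rewrite normr0 powR0//.
    by rewrite integral0 lee_fin ltW.
  under eq_fun do rewrite big_cons.
  split; first by apply: LpD => //; exact: LpZ.
  apply: approximableD; [|exact: Lp_measurable| |exact: IH2].
  + by apply: measurable_funM => //; exact: measurable_indic.
  + by apply: approximableZ; [exact: VI|exact: approximable_indic].
- apply: (Np_cvg0 Vf) => [n|n y|y].
  + by apply: measurable_funB => //; exact: Lp_measurable.
  + by rewrite distrC ger0_norm ?subr_ge0// gerBl.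
  + by rewrite -(subrr (f y)); apply: cvgB => //; exact: cvg_cst.
Qed.

Lemma dense_familyP f e : V f -> 0 < e ->
  exists n, (Np (fun y => (f y - dense_family n y)%R) <= e%:E)%E.
Proof.
move=> Vf e0.
suff /(_ e e0)[l fl] : approximable f.
  by exists (pickle l); rewrite /dense_family pickleK.
have -> : f = (fun y => (`|f y| + f y) + -1 * `|f y|).
  by apply/funext => y; rewrite mulN1r addrAC subrr add0r.
have Vn := Lp_norm Vf; have VD := LpD Vn Vf.
apply: approximableD.
- exact: Lp_measurable.
- exact/Lp_measurable/LpZ.
- apply: (approximable_ge0 VD) => y.
  by rewrite -lerBlDr sub0r -normrN ler_norm.
- by apply: (approximableZ _ Vn); apply: (approximable_ge0 Vn) => y.
Qed.

End density.

(** * Linear functionals below a coherent risk measure *)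

Definition selection_sequence (phi : X -> R) (n : nat) : X -> R :=
  if n is n'.+1 then dense_family n' else phi.

Definition risk_selection (rho : (X -> R) -> R) (phi : X -> R) :=
  lexicographic_derivative rho (selection_sequence phi).

Section risk_selection.
Context (rho : (X -> R) -> R) (phi : X -> R).
Context (coh : coherent P0 p rho) (Vphi : V phi).
Local Notation L := (risk_selection rho phi).

Lemma Lp_selection_sequence n : V (selection_sequence phi n).
Proof. by case: n => [//|n]; exact: Lp_dense_family. Qed.

Lemma risk_selection_sublinear : sublinear_on L.
Proof.
apply: lexicographic_derivative_sublinear; first exact: coherent_sublinear.
exact: Lp_selection_sequence.
Qed.

Lemma risk_selection_le f : V f -> L f <= rho f.
Proof.
apply: (lexicographic_derivative_le (coherent_sublinear coh) _ 0).
exact: Lp_selection_sequence.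
Qed.

Lemma risk_selection_self : L phi = rho phi.
Proof.
apply: (lexicographic_derivative_first (coherent_sublinear coh)).
exact: Lp_selection_sequence.
Qed.

(* The selection is odd on a dense family, and it is dominated by a functional
   which is continuous for the norm of L_p. *)
Lemma risk_selection_opp f : V f -> L (fun y => - f y) = - L f.
Proof.
move=> Vf; apply/eqP; rewrite eq_le; apply/andP; split; last first.
  have := sublinear_oppr risk_selection_sublinear (LpN Vf).
  by under eq_fun do rewrite opprK.
apply/ler_addgt0Pr => e e0; have e20 : 0 < e / 2 by rewrite divr_gt0.
have [dl dl0 H] := coherent_cont coh e20.
have [n fn] := dense_familyP Vf dl0; set F := dense_family n in fn.
have VF : V F by exact: Lp_dense_family.
have LF : L (fun y => - F y) = - L F.
  apply: (lexicographic_derivative_opp (coherent_sublinear coh) _ n.+1).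
  exact: Lp_selection_sequence.
have VB := LpB Vf VF; have VB' := LpB VF Vf.
have he := H _ VB fn.
have key k k' : V k -> V k' -> (forall y, k y - k' y <= `|f y - F y|) ->
    L k - L k' <= e / 2.
  move=> Vk Vk' kk'; rewrite lerBlDl.
  apply: (@le_trans _ _ (L k' + L (fun y => k y - k' y))).
    apply: le_trans (risk_selection_sublinear.1 _ _ Vk' (LpB Vk Vk')).
    by under [in leRHS]eq_fun do rewrite addrC subrK.
  rewrite lerD2l; apply: le_trans (risk_selection_le (LpB Vk Vk')) _.
  apply: le_trans he; apply: coherent_le => //; [exact: LpB|exact: Lp_norm].
have H1 : L (fun y => - f y) - L (fun y => - F y) <= e / 2.
  apply: key => [||y]; [exact: LpN|exact: LpN|].
  by rewrite opprK addrC -normrN opprB ler_norm.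
have H2 : L f - L F <= e / 2 by apply: key => // y; exact: ler_norm.
by move: H1 H2; rewrite LF; lra.
Qed.

End risk_selection.

(** * Probability measures with a density in L_q and their pairing with L_p *)

Section densities.
Context (m : probability X R) (Mm : Mset P0 p m).

Lemma Mset_dominates : m `<< P0.
Proof.
case: Mm => g /andP[/[!inE]/= mg _] mE; apply/null_content_dominatesP => B mB PB0.
rewrite mE//; apply: null_set_integral => //.
exact/measurable_EFinP/measurable_funTS.
Qed.

Let h := Radon_Nikodym_SigmaFinite.f m P0.

Let integral_density_lty f g : V f -> g \in Lfun P0 (hoelder_conjugate p%:E) ->
  (\int[P0]_y (`|f y * g y|)%:E < +oo)%E.
Proof.
move=> Vf gq; have /andP[/[!inE]/= mg gfin] := gq.
have mf := Lp_measurable Vf.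
have [p1|p1] := eqVneq p 1.
  move: gfin; rewrite /finite_norm p1 hoelder_conjugate1 unlock /Lnorm.
  rewrite (_ : (0 < P0 [set: X])%E); last by rewrite (_ : P0 _ = 1%E)//; exact: probability_setT.
  move=> gfin; have [C gC] : exists C : R, {ae P0, forall y, `|g y| <= C}.
    (* The value +oo contradicts the finite norm; for -oo the bound 0 serves. *)
    case E : (ess_sup_inf.ess_sup P0 (abse \o (EFin \o g))) gfin => [C| |] // _.
      by exists C; move/eqP: E; rewrite eq_le => /andP[/ess_sup_inf.ess_supP].
    exists 0; have /ess_sup_inf.ess_supP : (ess_sup_inf.ess_sup P0 (abse \o (EFin \o g)) <= 0%:E)%E.
      by rewrite E leNye.
    exact.
  have /LpP[_ Nf] := Vf.
  apply: (@le_lt_trans _ _ (\int[P0]_y (`|C|%:E * (`|f y| `^ p)%:E))%E).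
    apply: ae_ge0_le_integral => //.
    - by apply/measurable_EFinP; apply: measurableT_comp => //; exact: measurable_funM.
    - by apply: emeasurable_funM => //; exact/measurable_EFinP/measurable_norm_powR.
    - apply: filterS gC => y + _ => gy; rewrite -EFinM lee_fin p1 powRr1//.
      by rewrite normrM mulrC ler_wpM2r// (le_trans gy)// ler_norm.
  rewrite ge0_integralZl//; last exact/measurable_EFinP/measurable_norm_powR.
  exact: lte_mul_pinfty.
have p1' : 0 < p - 1 by rewrite subr_gt0 lt_neqAle eq_sym p1.
have qE : hoelder_conjugate p%:E = (p / (p - 1))%:E.
  rewrite /hoelder_conjugate/= eqe (negbTE p_neq0) -EFinB inver subr_eq0 (negbTE p1).
  by rewrite -EFinM.
rewrite -[X in (X < _)%E](_ : Lnorm P0 1 (EFin \o (f \* g)%R) = _); last first.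
  by rewrite Lnorm1; apply: eq_integral => y _.
have q0 : 0 < p / (p - 1) by rewrite divr_gt0.
have pq : p^-1 + (p / (p - 1))^-1 = 1 by field; rewrite p_neq0 gt_eqF.
apply: le_lt_trans (hoelder P0 mf mg p_gt0 q0 pq) _.
rewrite -qE; apply: lte_mul_pinfty; first exact: Lnorm_ge0.
- have /andP[_ /[!inE]/= Nf] := Vf.
  by rewrite ge0_fin_numE// Lnorm_ge0.
- exact: gfin.
Qed.

Lemma Mset_integrable f : V f -> m.-integrable setT (EFin \o f).
Proof.
move=> Vf; have mf := Lp_measurable Vf.
have mnf : measurable_fun setT (fun y => (`|f y|)%:E).
  by apply/measurable_EFinP; exact: measurableT_comp.
apply/integrableP; split; first exact/measurable_EFinP.
rewrite -[X in (X < _)%E](_ : \int[m]_y (`|f y|)%:E = _)%E//.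
rewrite -(Radon_Nikodym_SigmaFinite.change_of_variables Mset_dominates)//.
have [g gq mE] := Mm; have /andP[/[!inE]/= mg _] := gq.
have ih : P0.-integrable setT h.
  exact: Radon_Nikodym_SigmaFinite.f_integrable Mset_dominates.
have gh : ae_eq P0 setT h (EFin \o g).
  apply: integral_ae_eq => //; first exact/measurable_EFinP.
  move=> B _ mB; rewrite -mE//.
  by rewrite -(Radon_Nikodym_SigmaFinite.f_integral Mset_dominates).
apply: le_lt_trans (integral_density_lty Vf gq).
apply: ae_ge0_le_integral => //.
- by move=> y _; rewrite mule_ge0// (Radon_Nikodym_SigmaFinite.f_ge0 Mset_dominates).
- by apply: emeasurable_funM => //; exact: measurable_int ih.
- by apply/measurable_EFinP; apply: measurableT_comp => //; exact: measurable_funM.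
- apply: filterS gh => y /(_ I) hy _; rewrite -/h hy /= -EFinM lee_fin normrM.
  by rewrite ler_wpM2l// ler_norm.
Qed.

Lemma pairingD f g : V f -> V g ->
  pairing (fun y => f y + g y) m = pairing f m + pairing g m.
Proof. by move=> Vf Vg; apply: RintegralD => //; exact: Mset_integrable. Qed.

Lemma pairingZ a f : V f -> pairing (fun y => a * f y) m = a * pairing f m.
Proof. by move=> Vf; apply: RintegralZl => //; exact: Mset_integrable. Qed.

Lemma pairingB f g : V f -> V g ->
  pairing (fun y => f y - g y) m = pairing f m - pairing g m.
Proof. by move=> Vf Vg; apply: RintegralB => //; exact: Mset_integrable. Qed.

(** Integration against a single density is itself a coherent risk measure, so automatic continuity
    applies to it and yields norm bounds. *)
Lemma pairing_coherent : coherent P0 p (fun f => pairing f m).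
Proof.
split=> [a f g _ Vf Vg|f g Vf Vg fg|a f Vf|b f _ Vf].
- by rewrite pairingD ?pairingZ//; exact: LpZ.
- rewrite -subr_ge0 -pairingB//.
  (* The order hypothesis holds only almost surely. The positive part is nonnegative everywhere and
     differs from g - f on a P0-null set, which is also m-null. *)
  pose k y := Num.max (g y - f y) 0.
  have Vgf := LpB Vg Vf; have mgf := Lp_measurable Vgf.
  have -> : pairing (fun y => g y - f y) m = pairing k m.
    rewrite /pairing /Rintegral; congr fine; apply: ae_eq_integral => //.
    + exact/measurable_EFinP.
    + by apply/measurable_EFinP; exact: measurable_maxr.
    + apply: null_dominates_ae_eq Mset_dominates _ => //.
      apply: filterS fg => y fgy _; congr EFin; rewrite /k; apply/esym/max_idPl.
      by rewrite subr_ge0.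
  by apply: Rintegral_ge0 => y _; rewrite le_max lexx orbT.
- have := pairingD (Lp_cst a) Vf; rewrite [pairing _ _ + _ in RHS]addrC => ->.
  rewrite addrC; congr (_ + _).
  transitivity (a * fine (m setT)); first exact: Rintegral_cst.
  by rewrite probability_setT mulr1.
- exact: pairingZ.
Qed.

(** Guarantees that the countably many bounded parts [Mset_bounded] exhaust the set of densities. *)
Lemma pairing_bounded : exists n : nat, forall f, V f -> (Np f <= 1%:E)%E ->
  `|pairing f m| <= n%:R.
Proof.
have [dl dl0 H] := coherent_cont pairing_coherent ltr01.
pose c := dl `^ p^-1; have c0 : 0 < c by rewrite powR_gt0.
exists (Num.truncn c^-1).+1 => f Vf Nf.
apply: le_trans (ltW (truncnS_gt _)).
have Vn := Lp_norm Vf.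
apply: (@le_trans _ _ (pairing (fun y => `|f y|) m)).
  have := coherent_dist pairing_coherent Vf (Lp_cst 0).
  rewrite (coherent0 pairing_coherent) subr0.
  by under [in X in _ <= X -> _]eq_fun do rewrite subr0.
rewrite -[leRHS]mulr1 -ler_pdivrMl ?invr_gt0// invrK -pairingZ//.
have -> : (fun y => c * `|f y|) = (fun y => `|c * f y|).
  by apply/funext => y; rewrite normrM (ger0_norm (ltW c0)).
apply: H; [exact: LpZ|]; rewrite NpZ; last exact: Lp_measurable.
rewrite ger0_norm ?(ltW c0)// /c -powRrM mulVf// powRr1 ?(ltW dl0)//.
by rewrite -[leRHS]mule1; apply: lee_wpmul2l => //; rewrite lee_fin ltW.
Qed.

End densities.

(** * Measurability of the risk and of its subgradients *)

Section weak_star_measurability.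
Context (q_ : X -> probability X R) (Mq : forall x, Mset P0 p (q_ x)).
Context (mq : forall B, measurable B -> measurable_fun setT (fun x => q_ x B)).

Lemma measurable_pairing f : V f -> measurable_fun setT (fun x => pairing f (q_ x)).
Proof.
move=> Vf; have mf := Lp_measurable Vf.
apply: (measurableT_comp (fine_measurable measurableT)).
under eq_fun do rewrite integralE.
apply: emeasurable_funB.
  apply: (measurable_fun_integral_kernel (l := fun x => q_ x)) => //.
  exact/measurable_funepos/measurable_EFinP.
apply: (measurable_fun_integral_kernel (l := fun x => q_ x)) => //.
exact/measurable_funeneg/measurable_EFinP.
Qed.

(** A bounded set for the dual norm, tested only on members of the dense family: countably many
    conditions, so that its preimage under [q_] is measurable. *)
Definition Mset_bounded (n : nat) : set (probability X R) :=
  [set m | Mset P0 p m /\ forall k, (Np (dense_family k) <= 1%:E)%E ->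
    `|pairing (dense_family k) m| <= n%:R].

Lemma measurable_Mset_bounded n : measurable [set x | Mset_bounded n (q_ x)].
Proof.
rewrite (_ : [set x | _] = \bigcap_k [set x | (Np (dense_family k) <= 1%:E)%E ->
    `|pairing (dense_family k) (q_ x)| <= n%:R]); last first.
  by apply/seteqP; split=> x /=; [case=> _ H k _; exact: H|move=> H; split=> // k; exact: H].
apply: bigcapT_measurable => k.
have [kn|kn] := boolP ((Np (dense_family k) <= 1%:E)%E); last first.
  by rewrite (_ : [set x | _] = setT)//; apply/seteqP; split.
rewrite (_ : [set x | _] = [set x | `|pairing (dense_family k) (q_ x)| <= n%:R]); last first.
  by apply/seteqP; split=> x /=; [apply|move=> H _; exact: H].
rewrite -[X in measurable X]setTI; apply: measurable_fun_ler => //.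
by apply: measurableT_comp => //; exact/measurable_pairing/Lp_dense_family.
Qed.

(** Chosen so that 2^p (eta + eta) = 1: if [Np f] is at most eta, a member of the dense family
    within eta of f has [Np] at most 1 and can be used in [Mset_bounded]. *)
Let eta : R := (2 `^ p)^-1 / 2.
Let eta0 : 0 < eta. Proof. by rewrite divr_gt0// invr_gt0 powR_gt0. Qed.

Let small n m f : Mset_bounded n m -> V f -> (Np f <= eta%:E)%E ->
  `|pairing f m| <= n%:R + 1.
Proof.
move=> [Mm mn] Vf Nf; have coh := pairing_coherent Mm.
have [dl dl0 H] := coherent_cont coh ltr01.
have min0 : 0 < Num.min dl eta by rewrite lt_min dl0.
have [k fk] := dense_familyP Vf min0; set F := dense_family k in fk.
have VF : V F by exact: Lp_dense_family.
have NF : (Np F <= 1%:E)%E.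
  have -> : F = (fun y => f y + (F y - f y)) by apply/funext => y; rewrite addrC subrK.
  have := Np_add (Lp_measurable Vf) (Lp_measurable (LpB VF Vf)).
  move/le_trans; apply; rewrite [Np (fun y => F y - f y)]NpB.
  apply: (@le_trans _ _ ((2 `^ p)%:E * (eta%:E + eta%:E))%E).
    apply: lee_wpmul2l; first by rewrite lee_fin powR_ge0.
    apply: leeD Nf _; apply: le_trans fk _; by rewrite lee_fin ge_min lexx orbT.
  have p20 : 2 `^ p != 0 :> R by rewrite gt_eqF// powR_gt0.
  rewrite -EFinD -EFinM lee_fin (_ : _ * _ = 1)//.
  by rewrite /eta; field.
have := mn k NF; rewrite -/F => Fn.
rewrite -(subrK (pairing F m) (pairing f m)).
apply: le_trans (ler_normD _ _) _; rewrite addrC lerD//.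
apply: le_trans (coherent_dist coh Vf VF) _.
apply: (H _ (LpB Vf VF)); apply: le_trans fk _.
by rewrite lee_fin ge_min lexx.
Qed.

(** By rescaling, the bound becomes a modulus of continuity that depends on n alone. This
    equicontinuity extends convergence from the dense family to all of L_p. *)
Let small_scaled n m f e : Mset_bounded n m -> V f -> 0 < e ->
  (Np f <= ((e / (n%:R + 1)) `^ p * eta)%:E)%E -> `|pairing f m| <= e.
Proof.
move=> mn Vf e0 Nf; have n0 : 0 < n%:R + 1 :> R by rewrite ltr_wpDl.
pose s := e / (n%:R + 1); have s0 : 0 < s by rewrite divr_gt0.
have := @small n m (fun y => s^-1 * f y) mn (LpZ _ Vf).
rewrite NpZ; last exact: Lp_measurable.
rewrite pairingZ//; last exact: mn.1.
have si : 0 <= s^-1 by rewrite invr_ge0 ltW.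
rewrite normrM !(ger0_norm si) ler_pdivrMl// {2}/s divfK ?gt_eqF//; apply.
apply: (@le_trans _ _ ((s^-1 `^ p)%:E * (s `^ p * eta)%:E)%E).
  by apply: lee_wpmul2l => //; rewrite lee_fin powR_ge0.
by rewrite -EFinM mulrA -(powRM _ si (ltW s0)) mulVf ?gt_eqF// powR1 mul1r.
Qed.

Let Mset_bounded_cvg n (m_ : nat -> probability X R) m :
  (forall j, Mset_bounded n (m_ j)) -> Mset_bounded n m ->
  (forall k, pairing (dense_family k) (m_ j) @[j --> \oo] --> pairing (dense_family k) m) ->
  forall f, V f -> pairing f (m_ j) @[j --> \oo] --> pairing f m.
Proof.
move=> Mm_ Mm cF f Vf; apply/cvgrPdist_le => e e0.
have e30 : 0 < e / 3 by rewrite divr_gt0.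
have n0 : 0 < n%:R + 1 :> R by rewrite ltr_wpDl.
have dl0 : 0 < (e / 3 / (n%:R + 1)) `^ p * eta by rewrite mulr_gt0// powR_gt0 ?divr_gt0.
have [k fk] := dense_familyP Vf dl0; set F := dense_family k in fk.
have VF : V F by exact: Lp_dense_family.
have close m' : Mset_bounded n m' -> `|pairing f m' - pairing F m'| <= e / 3.
  move=> Mm'; rewrite -(pairingB Mm'.1)//.
  by apply: (small_scaled Mm') => //; exact: LpB.
have /cvgrPdist_le /(_ _ e30) := cF k; apply: filterS => j; rewrite -/F => cj.
have := close _ Mm; have := close _ (Mm_ j).
move: cj; rewrite !ler_norml => /andP[? ?] /andP[? ?] /andP[? ?].
by apply/andP; split; lra.
Qed.

Let test_topology_cvg (m_ : nat -> probability X R) m W :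
  weak_star_open P0 p W -> W m ->
  (forall f, V f -> pairing f (m_ j) @[j --> \oo] --> pairing f m) ->
  \forall j \near \oo, W (m_ j).
Proof.
case=> C oC <- /= Cm cf.
pose e (m' : probability X R) : prod_topology (fun _ : V => R) :=
  fun f : V => pairing (\val f) m'.
have ce : (fun j => e (m_ j)) @ \oo --> e m.
  apply/cvg_sup => f A /=.
  rewrite (@nbhsE (initial_topology (fun g : (V -> R) => g f))) => -[B [[D oD <-] Dm DA]].
  have nD : nbhs (pairing (\val f) m) D by exact: open_nbhs_nbhs.
  have := cf (\val f) (set_valP f) _ nD.
  by case=> N _ HN; exists N => // j Nj; apply: DA; exact: HN.
by apply: (ce C); apply: open_nbhs_nbhs.
Qed.

(** The length of r fixes both the number of tested functions and the tolerance, so that finite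
    lists of rationals index all these sets. *)
Let neighborhood (r : seq rat) : set (probability X R) :=
  [set m | forall i, (i < size r)%N ->
    `|pairing (dense_family i) m - ratr (nth 0 r i)| < (size r)%:R^-1].

Let measurable_neighborhood r : measurable [set x | neighborhood r (q_ x)].
Proof.
rewrite (_ : [set x | _] = \bigcap_i [set x | (i < size r)%N ->
    `|pairing (dense_family i) (q_ x) - ratr (nth 0 r i)| < (size r)%:R^-1]); last first.
  by apply/seteqP; split=> x /= H i; [move=> _; exact: H|exact: H].
apply: bigcapT_measurable => i.
case: (ltnP i (size r)) => ir; last first.
  by rewrite (_ : [set x | _] = setT)//; apply/seteqP; split.
rewrite (_ : [set x | _] =
    [set x | `|pairing (dense_family i) (q_ x) - ratr (nth 0 r i)| < (size r)%:R^-1]); last first.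
  by apply/seteqP; split=> x /=; [apply|move=> H _; exact: H].
rewrite -[X in measurable X]setTI; apply: measurable_fun_ltr => //.
apply: measurableT_comp => //; apply: measurable_funB => //.
exact/measurable_pairing/Lp_dense_family.
Qed.

(* On each of the countably many bounded parts of the set of densities the weak
   star topology has a countable base, although it has none on the whole set. *)
Lemma measurable_weak_star_open W : weak_star_open P0 p W ->
  measurable [set x | W (q_ x)].
Proof.
move=> oW.
pose good n r := neighborhood r `&` Mset_bounded n `<=` W.
pose A n (a : seq rat) := [set x | [/\ good n a, Mset_bounded n (q_ x) & neighborhood a (q_ x)]].
have mA n a : measurable (A n a).
  have [g|ng] := pselect (good n a); last first.
    by rewrite (_ : A n a = set0)//; apply/seteqP; split=> x // [].
  rewrite (_ : A n a = [set x | Mset_bounded n (q_ x)] `&` [set x | neighborhood a (q_ x)]).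
    by apply: measurableI; [exact: measurable_Mset_bounded|exact: measurable_neighborhood].
  by apply/seteqP; split=> x /= [].
pose B n k := if unpickle k is Some a then A n a else set0.
suff -> : [set x | W (q_ x)] = \bigcup_n \bigcup_k B n k.
  apply: bigcupT_measurable => n; apply: bigcupT_measurable => k.
  by rewrite /B; case: unpickle.
apply/seteqP; split=> [x /= Wx|x [n _ [k _]]]; last first.
  by rewrite /B; case: unpickle => // a [g b1 b2]; exact: g.
have [n Hn] := pairing_bounded (Mq x); exists n => //.
have bx : Mset_bounded n (q_ x).
  by split => // k; apply: Hn; exact: Lp_dense_family.
have rat_approx j i : exists r : rat,
    `|pairing (dense_family i) (q_ x) - ratr r| < j.+1%:R^-1.
  have j0 : 0 < j.+1%:R^-1 :> R by rewrite invr_gt0.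
  set a := pairing _ _.
  have [r] : exists r : rat, ratr r \in `]a, a + j.+1%:R^-1[ by apply: rat_in_itvoo; rewrite ltrDl.
  rewrite in_itv/= => /andP[ar ra]; exists r.
  by rewrite distrC ger0_norm ?subr_ge0 1?ltW// ltrBlDl.
pose r j i := sval (cid (rat_approx j i)).
have rP j i : `|pairing (dense_family i) (q_ x) - ratr (r j i)| < j.+1%:R^-1.
  exact: (svalP (cid (rat_approx j i))).
pose s j := mkseq (r j) j.+1.
have [[j gj]|ng] := pselect (exists j, good n (s j)).
  exists (pickle (s j)) => //; rewrite /B pickleK; split => // i.
  rewrite size_mkseq => ij; rewrite nth_mkseq//; exact: rP.
(* Otherwise each [s j] leaves room for a measure of the bounded part close to [q_ x] but outside W.
   These measures converge to [q_ x] on the dense family, hence weak star, against the openness of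
   W. *)
exfalso.
have /choice[m_ Hm] : forall j, exists m, [/\ neighborhood (s j) m, Mset_bounded n m & ~ W m].
  move=> j; apply: contrapT => H; apply: ng; exists j => m [Nm Bm].
  by apply: contrapT => nW; apply: H; exists m.
suff cm f : V f -> pairing f (m_ j) @[j --> \oo] --> pairing f (q_ x).
  have [N _ /(_ N (leqnn N))] := test_topology_cvg oW Wx cm.
  by case: (Hm N).
apply: (@Mset_bounded_cvg n) => //; first by move=> j; case: (Hm j).
move=> k; apply/cvgrPdist_le => e e0.
near=> j.
have kj : (k < j.+1)%N by rewrite ltnS; near: j; exact: nbhs_infty_ge.
have [Nj _ _] := Hm j; have := Nj k; rewrite size_mkseq nth_mkseq// => /(_ kj) mj.
have := rP j k => xj.
have je : j.+1%:R^-1 <= e / 2.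
  rewrite invf_ple ?posrE ?divr_gt0// invf_div; apply: ltW.
  rewrite (@lt_le_trans _ _ j%:R)// ?ler_nat//; near: j; exact: nbhs_infty_gtr.
move: mj xj je; move: (j.+1%:R^-1 : R) => u.
rewrite !ltr_norml ler_norml => /andP[? ?] /andP[? ?] ?.
by apply/andP; split; lra.
Unshelve. all: by end_near. Qed.

End weak_star_measurability.

Section measurable_risk.
Context (sigma : (X -> R) -> X -> probability X R -> R).
Context (sigma_risk : risk_transition_mapping P0 p sigma).
Context (q_ : X -> probability X R) (Mq : forall x, Mset P0 p (q_ x)).
Context (mq : forall B, measurable B -> measurable_fun setT (fun x => q_ x B)).

Local Notation rho x := (fun f => sigma f x (q_ x)).

Let coh x : coherent P0 p (rho x). Proof. exact: sigma_risk.2. Qed.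

(** The sets E with measurable preimage under x |-> (psi, x, q_ x) form a sigma-algebra. On a
    generating product the L_p factor only decides whether the preimage is empty. *)
Lemma measurable_risk_fixed psi : V psi -> measurable_fun setT (fun x => rho x psi).
Proof.
move=> Vpsi _ B mB; rewrite setTI.
have [E sE EB] := sigma_risk.1 B mB.
rewrite (_ : _ @^-1` _ = [set x | E (psi, x, q_ x)]); last first.
  by apply/seteqP; split=> x /= H; apply/(EB psi x (q_ x) Vpsi (Mq x)).
move: E sE {EB}; apply: (@smallest_sub _ _ _ [set E | measurable [set x | E (psi, x, q_ x)]]).
- split => /=.
  + by rewrite (_ : [set x | _] = set0).
  + move=> A mA; rewrite (_ : [set x | _] = ~` [set x | A (psi, x, q_ x)]).
      exact: measurableC.
    by apply/seteqP; split=> x /=; [case|].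
  + move=> F mF; rewrite (_ : [set x | _] = \bigcup_i [set x | F i (psi, x, q_ x)]).
      exact: bigcupT_measurable.
    by apply/seteqP; split=> x [i _ Fi]; exists i.
- move=> _ [G [A [W [oG mA oW ->]]]] /=.
  have [Gpsi|nG] := pselect (G psi); last first.
    by rewrite (_ : [set x | _] = set0)//; apply/seteqP; split=> x // [[]].
  rewrite (_ : [set x | _] = A `&` [set x | W (q_ x)]).
    by apply: measurableI => //; exact: measurable_weak_star_open.
  by apply/seteqP; split=> x /= [] // []; split.
Qed.

(** The section at x is replaced by the first member of the dense family within 1/(n+1) of it. This
    choice splits the space into countably many measurable pieces with a fixed function on each, and
    continuity of the risk gives the limit. *)
Lemma measurable_risk_joint (g : X * X -> R) : measurable_fun setT g ->
  (forall x, V (fun y => g (x, y))) ->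
  measurable_fun setT (fun x => rho x (fun y => g (x, y))).
Proof.
move=> mg Vg.
pose dst k x := Np (fun y => (g (x, y) - dense_family k y)%R).
have mdst k : measurable_fun setT (dst k).
  pose G (z : X * X) := (`|g z - dense_family k z.2| `^ p)%:E.
  apply: (@measurable_fun_fubini_tonelli_F _ _ _ _ _ P0 G).
    apply/measurable_EFinP; apply: (measurableT_comp (measurable_powR _)).
    apply: measurableT_comp => //; apply: measurable_funB => //.
    by apply: measurableT_comp => //; exact/Lp_measurable/Lp_dense_family.
  by move=> z; rewrite lee_fin powR_ge0.
have ex n x : exists k, (dst k x <= (n.+1%:R^-1 : R)%:E)%E.
  by apply: dense_familyP => //; rewrite invr_gt0.
pose kk n x := ex_minn (ex n x).
have kkP n x : (dst (kk n x) x <= (n.+1%:R^-1 : R)%:E)%E.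
  by rewrite /kk; case: ex_minnP.
have mle n k : measurable [set x | (dst k x <= (n.+1%:R^-1 : R)%:E)%E].
  by rewrite -[X in measurable X]setTI; exact: emeasurable_fun_le.
have mkk n k : measurable [set x | kk n x = k].
  rewrite (_ : [set x | _] = [set x | (dst k x <= (n.+1%:R^-1 : R)%:E)%E] `&`
      \bigcap_(i in `I_k) ~` [set x | (dst i x <= (n.+1%:R^-1 : R)%:E)%E]).
    apply: measurableI; first exact: mle.
    by apply: bigcap_measurableType => i _; apply: measurableC; exact: mle.
  apply/seteqP; split=> x /=.
    rewrite /kk; case: ex_minnP => m H1 H2 <-; split => // i /= im.
    by move/H2; rewrite leqNgt im.
  move=> [H1 H2]; rewrite /kk; case: ex_minnP => m H3 H4; apply/eqP.
  rewrite eqn_leq H4//= leqNgt; apply/negP => mk.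
  exact: (H2 m mk).
apply: (measurable_fun_cvg (h := fun n x => rho x (dense_family (kk n x)))).
  move=> n _ B mB; rewrite setTI.
  rewrite (_ : _ @^-1` _ = \bigcup_k ([set x | kk n x = k] `&`
      [set x | B (rho x (dense_family k))])).
    apply: bigcupT_measurable => k; apply: measurableI => //.
    rewrite -[X in measurable X]setTI; apply: measurable_risk_fixed => //.
    exact: Lp_dense_family.
  apply/seteqP; split=> x /=; first by exists (kk n x).
  by case=> k _ [/= ->].
move=> x _; apply: (coherent_cvg (coh x)) => // [n|]; first exact: Lp_dense_family.
apply/fine_cvgP; split.
  near=> n; rewrite ge0_fin_numE ?Np_ge0//; rewrite NpB.
  by apply: le_lt_trans (kkP n x) _; rewrite ltry.
apply/cvgrPdist_le => e e0; near=> n; rewrite sub0r normrN ger0_norm ?fine_ge0 ?Np_ge0//.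
rewrite -lee_fin fineK; last first.
  rewrite ge0_fin_numE ?Np_ge0//; rewrite NpB.
  by apply: le_lt_trans (kkP n x) _; rewrite ltry.
rewrite NpB; apply: le_trans (kkP n x) _; rewrite lee_fin.
rewrite invf_ple ?posrE//; apply: ltW.
rewrite (@lt_le_trans _ _ n%:R)// ?ler_nat//; near: n; exact: nbhs_infty_gtr.
Unshelve. all: by end_near. Qed.

(** Both limits in the construction run over the natural numbers, so only pointwise limits of
    sequences of measurable functions occur. *)
Lemma measurable_risk_selection phi f : V phi -> V f ->
  measurable_fun setT (fun x => risk_selection (rho x) phi f).
Proof.
move=> Vphi; pose h := selection_sequence phi.
have Vh n : V (h n) by exact: Lp_selection_sequence.
have cs x := coherent_sublinear (coh x).
have mD k : forall f, V f -> measurable_fun setT (fun x => iterated_derivative (rho x) h k f).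
  elim: k => [|k IH] g Vg; first exact: measurable_risk_fixed.
  apply: (measurable_fun_cvg (h := fun n x => difference_quotient
    (iterated_derivative (rho x) h k) (h k) n%:R g)) => [n|x _].
    apply: measurable_funB; first by apply: IH; apply: LpD => //; exact: LpZ.
    by apply: measurable_funM => //; exact: IH.
  apply: difference_quotient_cvg => //.
  exact: iterated_derivative_sublinear.
move=> Vf; apply: (measurable_fun_cvg (h := fun k x => iterated_derivative (rho x) h k f)).
  by move=> k; exact: mD.
by move=> x _; exact: lexicographic_derivative_cvg.
Qed.

Lemma measurable_risk_envelope_selection phi : V phi -> exists k : X -> probability X R,
  [/\ forall B, measurable B -> measurable_fun setT (fun x => k x B),
      forall x, risk_envelope P0 p sigma x (q_ x) (k x) &
      forall x, pairing phi (k x) = rho x phi].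
Proof.
move=> Vphi.
have H x : exists mu : probability X R, [/\ Mset P0 p mu,
    forall f, V f -> pairing f mu = risk_selection (rho x) phi f &
    forall B, measurable B -> mu B = (risk_selection (rho x) phi \1_B)%:E].
  apply: (@functional_probability (rho x)) => //.
  - exact: risk_selection_sublinear.
  - by move=> f; exact: risk_selection_le.
  - by move=> f; exact: risk_selection_opp.
have /choice[k kP] := H; exists k; split.
- move=> B mB; rewrite (_ : (fun x => _) =
    (fun x => (risk_selection (rho x) phi \1_B)%:E)); last first.
    by apply/funext => x; have [_ _ ->] := kP x.
  by apply/measurable_EFinP; apply: measurable_risk_selection => //; exact: Lp_indic.
- move=> x; have [Mk kE _] := kP x; split => // f Vf.
  rewrite (coherent0 (coh x)) add0r (_ : f \- _ = f); last first.
    by apply/funext => y /=; rewrite subr0.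
  by rewrite kE//; exact: risk_selection_le.
- by move=> x; have [_ E _] := kP x; rewrite E//; exact: risk_selection_self.
Qed.

End measurable_risk.

(** * Transience and the fixed point equation *)

Section controlled_model.
Context (dU : measure_display) (U : borelSpaceType R dU).
Context (Uf : X -> set U) (Q : X -> U -> probability X R) (pi : X -> U).

(* By setwise continuity the superlevel sets of Q B are relatively open in the
   graph of Uf, hence traces of countable unions of basic rectangles. *)
Lemma measurable_transition B : G1 Uf Q -> decision_rule Uf pi -> measurable B ->
  measurable_fun setT (fun x => Q x (pi x) B).
Proof.
move=> g1 [mpi Upi] mB.
have [b [ob bP]] := borel_countable_base_cvg X.
have [b' [ob' bP']] := borel_countable_base_cvg U.
apply: (measurability _ (ErealGenOInfty.measurableE R)) => _ [_ [a ->] <-].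
rewrite setTI.
pose good i j := forall x u, Uf x u -> b i x -> b' j u -> (a%:E < Q x u B)%E.
pose A i j := [set x | [/\ good i j, b i x & b' j (pi x)]].
rewrite (_ : _ @^-1` _ = \bigcup_i \bigcup_j A i j).
  apply: bigcupT_measurable => i; apply: bigcupT_measurable => j.
  have [g|ng] := pselect (good i j); last first.
    by rewrite (_ : A i j = set0)//; apply/seteqP; split=> x // [].
  rewrite (_ : A i j = b i `&` pi @^-1` b' j).
    apply: measurableI; first exact: open_measurable_borel.
    by rewrite -[X in measurable X]setTI; apply: mpi => //; exact: open_measurable_borel.
  by apply/seteqP; split=> x /= [].
apply/seteqP; split=> [x /=|x [i _ [j _ [g bx bu]]]]; last first.
  by rewrite /= in_itv/= andbT; exact: g.
rewrite in_itv/= andbT => ax; apply: contrapT => nA.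
have [i_ [bx cx]] := bP x; have [j_ [bu cu]] := bP' (pi x).
(* If no good rectangle contains (x, pi x), the shrinking rectangles around it contain points of the
   graph where the bound a fails; they converge to it, against setwise continuity. *)
have /choice[z Hz] : forall n, exists z : X * U, [/\ Uf z.1 z.2, b (i_ n) z.1,
    b' (j_ n) z.2 & ~ (a%:E < Q z.1 z.2 B)%E].
  move=> n; apply: contrapT => H; apply: nA; exists (i_ n) => //; exists (j_ n) => //.
  split=> // y u Uyu by_ bu_; apply: contrapT => nlt; apply: H.
  by exists (y, u).
have Hc : Q (z k).1 (z k).2 B @[k --> \oo] --> Q x (pi x) B.
  apply: (g1 B mB (fun k => (z k).1) (fun k => (z k).2)) => //.
  - by move=> k; case: (Hz k).
  - by apply: cx => n; case: (Hz n).
  - by apply: cu => n; case: (Hz n).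
have : \forall k \near \oo, (a%:E < Q (z k).1 (z k).2 B)%E.
  apply: (Hc [set y | (a%:E < y)%E]); apply: open_nbhs_nbhs; split => //.
  exact: open_ereal_gt_ereal.
by case=> N _ /(_ N (leqnn N)); case: (Hz N).
Qed.

Context (c : X -> U -> X -> R) (xA : X) (w : X -> R).
Context (sigma : (X -> R) -> X -> probability X R -> R).
Context (xA_abs : absorbing Uf Q c xA) (w_ge1 : forall x, 1 <= w x) (Vw : V w).
Context (sigma_risk : risk_transition_mapping P0 p sigma).
Context (sigma_law : law_invariant P0 p sigma).
Context (hG0 : G0 P0 p Uf Q) (hG1 : G1 Uf Q) (hG3 : G3 Uf w c).
Context (pi_rule : decision_rule Uf pi).
Context (transient : risk_transient P0 p Q sigma xA w pi).

Let q x := Q x (pi x).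
Local Notation rho x := (fun f => sigma f x (q x)).
Local Notation D := (transient_states xA).
Local Notation MM := (risk_multikernel P0 p Q sigma xA pi).

Let Mq x : Mset P0 p (q x). Proof. exact/hG0/pi_rule.2. Qed.
Let mq B : measurable B -> measurable_fun setT (fun x => q x B).
Proof. exact: measurable_transition. Qed.
Let coh x : coherent P0 p (rho x). Proof. exact: sigma_risk.2. Qed.
Let mD : measurable D. Proof. exact/measurableC/measurable_borel_set1. Qed.
Let w_ge0 x : 0 <= w x. Proof. exact: le_trans ler01 (w_ge1 x). Qed.

(* Law invariance identifies f with 0 under the Dirac measure at xA. *)
Lemma risk_absorbing f : V f -> f xA = 0 -> rho xA f = 0.
Proof.
move=> Vf f0; have [Q1 _] := xA_abs (pi_rule.2 xA).
rewrite -(coherent0 (coh xA)); apply: sigma_law => //; first exact: Lp_cst.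
move=> t; have mA (B : set X) : measurable B -> B xA -> q xA B = 1%E.
  move=> mB BxA; apply/eqP; rewrite eq_le probability_le1//= -Q1.
  by apply: le_measure; rewrite ?inE//; [exact: measurable_borel_set1|move=> _ ->].
have mt : measurable [set y | f y <= t].
  rewrite -[X in measurable X]setTI; apply: measurable_fun_ler => //.
  exact: Lp_measurable.
have [t0|t0] := leP 0 t.
  rewrite !mA//=; last by rewrite f0.
  by rewrite (_ : [set _ | _] = setT)//; apply/seteqP; split.
rewrite [RHS](_ : _ = 0%E); last first.
  by rewrite -(measure0 (q xA)); congr (q xA _); apply/seteqP; split.
apply/eqP; rewrite eq_le measure_ge0 andbT.
have := mA (~` [set y | f y <= t]) (measurableC mt).
rewrite probability_setC// => H; have {}H : (1 - q xA [set y | (f y <= t)%R] = 1)%E.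
  by apply: H => /=; rewrite f0 leNgt t0.
have qfin : q xA [set y | f y <= t] \is a fin_num by exact: fin_num_measure.
move: H; rewrite -(fineK qfin) -EFinB => -[] H.
by rewrite lee_fin; lra.
Qed.

(** A function vanishing at [xA] has risk 0 there, so all iterates vanish at [xA] too; and its
    integral over [D] is the integral over the whole space. *)
Let wt (x : X) : R := \1_D x * w x.

Let wt_xA : wt xA = 0.
Proof. by rewrite /wt indicE memNset ?mul0r// => H; exact: H. Qed.

Let wtE x : x != xA -> wt x = w x.
Proof. by move=> xxA; rewrite /wt indicE mem_set ?mul1r//; exact/eqP. Qed.

Let wt_ge0 x : 0 <= wt x. Proof. by rewrite mulr_ge0// indicE. Qed.

Let wt_le x : wt x <= w x.
Proof. by rewrite /wt indicE; case: (_ \in _); rewrite ?mul1r ?mul0r. Qed.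

Let Vwt : V wt.
Proof.
apply: (Lp_le _ Vw) => [|x]; last by rewrite !ger0_norm.
by apply: measurable_funM; [exact: measurable_indic|exact: Lp_measurable].
Qed.

Fixpoint risk_iterate (j : nat) : X -> R :=
  if j is j'.+1 then fun x => rho x (risk_iterate j') else wt.
Local Notation phi := risk_iterate.

Let transition_kernel f : V f -> (forall x, 0 <= f x) -> f xA = 0 ->
  exists K : R.-fker X ~> X, [/\ selector D K MM,
    forall x, K x (~` D) = 0%E &
    forall x, (\int[K x]_y (f y)%:E = (rho x f)%:E)%E].
Proof.
move=> Vf f0 fA.
have [k [mk kenv kf]] := measurable_risk_envelope_selection sigma_risk Mq mq Vf.
have [K [KE Kint]] := restricted_kernel mD mk; exists K; split.
- by move=> x _; exists (k x); [exact: kenv|move=> B mB; exact: KE].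
- by move=> x; apply: etrans (KE x _) _; rewrite setICl measure0.
- move=> x; have ki := Mset_integrable (kenv x).1 Vf.
  rewrite -kf /pairing /Rintegral fineK; last exact: integrable_fin_num ki.
  apply: Kint => [y||y nDy]; first by rewrite lee_fin.
  + exact: measurable_int ki.
  + rewrite (_ : y = xA) ?fA//; apply: contrapT => yA; apply: nDy => /=; exact: yA.
Qed.

(** Powers of multikernels start at 1, hence the shift: index j stands for [phi j.+1], attained by a
    (j+1)-fold composition. *)
Let iterated_kernel j := exists N : R.-fker X ~> X,
  selector D N (mk_pow D MM j.+1) /\
  forall x, (\int[N x]_y (wt y)%:E = (phi j.+1 x)%:E)%E.

Let sum_kernel T : (forall j, (j < T)%N -> iterated_kernel j) ->
  exists N : R.-ker X ~> X, selector D N (mk_sum_pow D MM T) /\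
  forall x, (\int[N x]_y (wt y)%:E = (\sum_(1 <= j < T.+1) phi j x)%:E)%E.
Proof.
elim: T => [|T IH] H.
  exists [the R.-ker X ~> X of @kzero _ _ X X R]; split.
    move=> x _; exists (fun=> mzero); split=> [j|B mB].
      by case: j.
    by rewrite big_geq.
  by move=> x; rewrite integral_measure_zero big_geq.
have [j jT|S [Ssel Sint]] := IH; first exact/H/ltnW.
have [N [Nsel Nint]] := H T (ltnSn T).
exists [the R.-ker X ~> X of kadd S N]; split.
  move=> x Dx; have [nu [nuP nuE]] := Ssel x Dx.
  exists (fun j => if j == T.+1 then N x else nu j); split=> [j /andP[j1 jT]|B mB].
    case: eqVneq => [->|jT']; first exact: Nsel.
    by apply: nuP; rewrite j1 -ltnS ltn_neqAle jT'.
  apply: etrans (measure_addE (S x) (N x) B) _.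
  rewrite nuE// [RHS]big_nat_recr//= eqxx; congr (_ + _)%E.
  by apply: eq_big_nat => j /andP[_ jT]; rewrite ltn_eqF.
move=> x; rewrite [RHS](_ : _ = (\sum_(1 <= j < T.+1) phi j x)%:E + (phi T.+1 x)%:E)%E.
  rewrite -Sint -Nint; apply: ge0_integral_measure_add => //.
    by move=> y _; rewrite lee_fin.
  exact/measurable_EFinP/Lp_measurable.
by rewrite big_nat_recr//= EFinD.
Qed.

(** The kernels enter as a hypothesis because the induction that constructs them already uses this
    bound. The maximum with 1 makes the constant valid for phi_0 as well. *)
Let weight_bound : exists2 K : R, 1 <= K & forall T, (forall j, (j < T)%N -> iterated_kernel j) ->
  forall x, x != xA -> \sum_(1 <= j < T.+1) phi j x <= K * w x.
Proof.
have [K0 HK] := transient.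
exists (Num.max 1 K0) => [|T HT x xxA]; first by rewrite le_max lexx.
have Dx : D x by exact/eqP.
have [S [Ssel Sint]] := sum_kernel HT.
apply: (@le_trans _ _ (K0 * w x)); last by rewrite ler_wpM2r// le_max lexx orbT.
have : ((w x)^-1%:E * \int[S x]_(y in D) (w y)%:E <= K0%:E)%E.
  apply: le_trans (HK T S Ssel); apply: ereal_sup_ubound; exists x => //.
rewrite (_ : \int[S x]_(y in D) (w y)%:E = (\sum_(1 <= j < T.+1) phi j x)%:E)%E.
  by rewrite -EFinM lee_fin ler_pdivrMl ?(lt_le_trans ltr01)// mulrC.
rewrite -Sint integral_mkcond; apply: eq_integral => y _.
by rewrite /= epatch_indic /wt EFinM muleC.
Qed.

Let K := s2val (cid2 weight_bound).
Let K_ge1 : 1 <= K. Proof. exact: (s2valP (cid2 weight_bound)). Qed.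
Let K_ge0 : 0 <= K. Proof. exact: le_trans ler01 K_ge1. Qed.
Let KP T : (forall j, (j < T)%N -> iterated_kernel j) ->
  forall x, x != xA -> \sum_(1 <= j < T.+1) phi j x <= K * w x.
Proof. exact: (s2valP' (cid2 weight_bound)). Qed.

Let iterate_good j := [/\ V (phi j), forall x, 0 <= phi j x, phi j xA = 0 & iterated_kernel j].

(** The claims depend on each other: the kernels below index j bound phi_j by K w, which puts phi_j
    into L_p, and this membership gives a one-step kernel attaining the risk of phi_j. Composed with
    the kernel that attains phi_j, it attains phi_(j+1). *)
Let iterate_goodP j : iterate_good j.
Proof.
have [n jn] := ubnP j; elim: n => // n IH in j jn *.
have Hj i : (i < j)%N -> iterate_good i.
  by move=> ij; apply: IH; exact: leq_trans ij (jn : (j <= n)%N).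
have [Vj j0 jA] : [/\ V (phi j), forall x, 0 <= phi j x & phi j xA = 0].
  case: j jn Hj => [_ _|j jn Hj]; first by split.
  have [Vj' j0' jA' _] := Hj j (ltnSn j).
  have j0 x : 0 <= phi j.+1 x.
    rewrite -(coherent0 (coh x)) /=; apply: (coherent_le (coh x)) => //; exact: Lp_cst.
  have jA : phi j.+1 xA = 0 by exact: risk_absorbing.
  split => //; apply: (Lp_le (g := fun x => K * w x)) => [||x].
  - exact: measurable_risk_fixed.
  - exact: LpZ.
  - rewrite !ger0_norm ?mulr_ge0//; have [->|xxA] := eqVneq x xA.
      by rewrite jA mulr_ge0.
    have KPj : forall i, (i < j.+1)%N -> iterated_kernel i by move=> i ij; case: (Hj i ij).
    apply: le_trans (KP KPj xxA).
    rewrite big_nat_recr//= lerDr big_nat; apply: sumr_ge0 => i /andP[_ ij].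
    by case: (Hj i ij).
split => //; have [K1 [K1sel K1D K1int]] := transition_kernel Vj j0 jA.
case: j jn Hj Vj j0 jA K1int => [|j] jn Hj Vj j0 jA K1int.
  by exists K1; split.
have [_ _ _ [N [Nsel Nint]]] := Hj j (ltnSn j).
have [K2 [K2E K2int]] := composed_kernel K1 N; exists K2; split.
  move=> x Dx; exists K1; exists N; split => // B mB; rewrite K2E.
  (* [mk_comp] integrates over [D] only; nothing is lost, as [K1] gives no mass to the
     complement. *)
  apply/esym; apply: (integral_support mD (K1D x)) => //; exact: measurable_kernel.
move=> x; rewrite K2int//; last exact/measurable_EFinP/Lp_measurable.
by under eq_integral do rewrite Nint.
Qed.

Let Vphi j : V (phi j). Proof. by case: (iterate_goodP j). Qed.
Let phi_ge0 j x : 0 <= phi j x. Proof. by case: (iterate_goodP j). Qed.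
Let phi_xA j : phi j xA = 0. Proof. by case: (iterate_goodP j). Qed.

Let sum_phi_le T x : \sum_(1 <= j < T.+1) phi j x <= K * wt x.
Proof.
have [->|xxA] := eqVneq x xA; first by rewrite wt_xA mulr0 big1// => j _.
by rewrite wtE//; apply: KP => // j _; case: (iterate_goodP j).
Qed.

Let phi_le j x : phi j x <= K * wt x.
Proof.
case: j => [|j]; first by rewrite /= ler_peMl.
apply: le_trans (sum_phi_le j.+1 x); rewrite big_nat_recr//= lerDr.
by apply: sumr_ge0 => i _; exact: phi_ge0.
Qed.

(** For j = 0 this is the bound by K phi_0; monotonicity and homogeneity of the risk carry it
    through j applications of S. *)
Let phi_shift_le n j x : phi (n + j) x <= K * phi j x.
Proof.
elim: j x => [|j IH] x; first by rewrite addn0; exact: phi_le.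
rewrite addnS /= -(coherentZ (coh x))//.
by apply: (coherent_le (coh x)) => //; exact: LpZ.
Qed.

(* T phi_T <= K (phi_1 + ... + phi_T) <= K^2 w *)
Let phi_decay T x : phi T.+1 x <= K ^+ 2 / T.+1%:R * wt x.
Proof.
have : T.+1%:R * phi T.+1 x <= K * \sum_(1 <= j < T.+2) phi j x.
  rewrite mulr_sumr mulr_natl (_ : T.+1 = T.+2 - 1)%N; last by rewrite subSS subn0.
  rewrite -sumr_const_nat big_nat [leRHS]big_nat; apply: ler_sum => j /andP[_ jT].
  have := phi_shift_le (T.+1 - j) j x; rewrite subnK; last exact: jT.
  by rewrite subSS subn0.
move=> /le_trans /(_ (ler_wpM2l K_ge0 (sum_phi_le _ _))).
rewrite -ler_pdivlMl// (_ : _ * (K * (K * wt x)) = K ^+ 2 / T.+1%:R * wt x)//.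
by rewrite expr2 mulrC; ring.
Qed.

Let phi_cvg0 a x : a * phi T x @[T --> \oo] --> 0.
Proof.
apply/cvgrPdist_le => e e0.
pose b := `|a| * (K ^+ 2 * wt x).
have b0 : 0 <= b by rewrite !mulr_ge0// exprn_ge0.
near=> T; rewrite sub0r normrN normrM [`|phi T x|]ger0_norm//.
have T0 : (0 < T)%N by near: T; exact: nbhs_infty_gt.
have := phi_decay T.-1 x; rewrite prednK// => /(ler_wpM2l (normr_ge0 a)).
move=> /le_trans; apply.
rewrite (_ : _ * (_ / _ * _) = b / T%:R); last by rewrite /b; ring.
rewrite ler_pdivrMr ?ltr0n// mulrC -ler_pdivrMr//.
by near: T; exact: nbhs_infty_ger.
Unshelve. all: by end_near. Qed.

(** * The cost operator and the finite-horizon risks *)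

Let stage_cost f (x y : X) := c x (pi x) y + f y.
Let operator f x := rho x (stage_cost f x).

Let c_bound : exists2 C : R, 0 < C & forall x y, `|c x (pi x) y| <= C * (w x + w y).
Proof. by have [_ [C C0 HC] _] := hG3; exists C => // x y; apply: HC; exact: pi_rule.2. Qed.

Let measurable_cost : measurable_fun setT (fun z : X * X => c z.1 (pi z.1) z.2).
Proof.
have [mc _ _] := hG3.
have mt : measurable_fun setT (fun z : X * X => ((z.1, pi z.1), z.2)).
  apply: measurable_fun_pair => //; apply: measurable_fun_pair => //.
  exact: measurableT_comp pi_rule.1 measurable_fst.
exact: (measurableT_comp mc mt).
Qed.

Let V_cost x : V (fun y => c x (pi x) y).
Proof.
have [C C0 HC] := c_bound.
apply: (Lp_le (g := fun y => C * (w x + w y))) => [||y].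
- exact: (measurableT_comp measurable_cost (measurable_pair1 x)).
- by apply: LpZ; apply: LpD => //; exact: Lp_cst.
- by rewrite [leRHS]ger0_norm// mulr_ge0 ?addr_ge0// ltW.
Qed.

Let V_stage_cost f x : V f -> V (stage_cost f x).
Proof. by move=> Vf; apply: LpD => //; exact: V_cost. Qed.

Let operator_xA f : V f -> f xA = 0 -> operator f xA = 0.
Proof.
move=> Vf f0; apply: risk_absorbing; first exact: V_stage_cost.
by rewrite /stage_cost f0 addr0; have [_ ->] := xA_abs (pi_rule.2 xA).
Qed.

Let operator_measurable f : V f -> measurable_fun setT (operator f).
Proof.
move=> Vf.
apply: (measurable_risk_joint sigma_risk Mq mq (g := fun z => stage_cost f z.1 z.2)).
  apply: measurable_funD; first exact: measurable_cost.
  by apply: measurableT_comp => //; exact: Lp_measurable.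
by move=> x; exact: V_stage_cost.
Qed.

Let operator_dist a j f g : 0 <= a -> V f -> V g -> (forall y, `|f y - g y| <= a * phi j y) ->
  forall x, `|operator f x - operator g x| <= a * phi j.+1 x.
Proof.
move=> a0 Vf Vg fg x.
apply: le_trans (coherent_dist (coh x) (V_stage_cost x Vf) (V_stage_cost x Vg)) _.
rewrite /= -(coherentZ (coh x))//; apply: (coherent_le (coh x)).
- by apply: Lp_norm; apply: LpB; exact: V_stage_cost.
- exact: LpZ.
- by move=> y; rewrite /stage_cost opprD addrACA subrr add0r.
Qed.

(** Converts a bound by w into one by phi_0, the form from which [operator_dist] can be iterated. *)
Let le_weight f a : V f -> f xA = 0 -> 0 <= a -> (forall x, `|f x| <= a * w x) ->
  forall x, `|f x| <= a * wt x.
Proof.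
move=> Vf fA a0 fw x; have [->|xxA] := eqVneq x xA; last by rewrite wtE.
by rewrite fA normr0 mulr_ge0.
Qed.

Let operator0_bound : exists2 C : R, 0 <= C & forall x, `|operator (fun=> 0) x| <= C * w x.
Proof.
have [C C0 HC] := c_bound; have C0' := ltW C0.
(* The constant comes from w y <= w xA + wt y, where w xA pays for the point at which [wt] vanishes.
   The risk of [wt] is phi_1 <= K w, and w xA <= w xA * w x because w is at least 1. *)
have KwA0 : 0 <= 1 + K + w xA by rewrite !addr_ge0.
exists (C * (1 + K + w xA)) => [|x]; first by rewrite mulr_ge0.
have V0 := V_stage_cost x (Lp_cst 0).
have Vb : V (fun y => C * (w x + w xA + wt y)).
  by apply: LpZ; apply: LpD => //; exact: Lp_cst.
have := coherent_dist (coh x) V0 (Lp_cst 0).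
rewrite (coherent0 (coh x)) subr0 => /le_trans; apply.
apply: (@le_trans _ _ (rho x (fun y => C * (w x + w xA + wt y)))).
  apply: (coherent_le (coh x)) => // [|y].
    by apply: Lp_norm; apply: LpB => //; exact: Lp_cst.
  rewrite subr0 /stage_cost addr0; apply: le_trans (HC x y) _; rewrite ler_wpM2l//.
  rewrite -addrA lerD2l; have [->|yA] := eqVneq y xA; first by rewrite wt_xA addr0.
  by rewrite wtE// lerDr.
rewrite (coherentZ (coh x))//; last by apply: LpD => //; exact: Lp_cst.
rewrite -mulrA ler_wpM2l// (coherent_cst (coh x))//.
have : rho x wt <= K * w x.
  by apply: le_trans (phi_le 1 x) _; rewrite ler_wpM2l.
have : w xA <= w xA * w x by rewrite ler_peMr.
by move=> ? ?; rewrite !mulrDl mul1r; lra.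
Qed.

Local Notation JT := (J Q c sigma pi).

(** The bound carried through the induction grows with T; it serves only to keep each finite-horizon
    risk in L_p. The uniform bound comes afterwards. *)
Let J_good T : V (JT T) /\ JT T xA = 0.
Proof.
have [C C0 HC] := operator0_bound.
suff [[]] : (V (JT T) /\ JT T xA = 0) /\
    exists2 a : R, 0 <= a & forall x, `|JT T x| <= a * w x by [].
elim: T => [|T [[VT TA] [a a0 aT]]].
  split; first by split => //; exact: Lp_cst.
  by exists 0 => // x; rewrite /= normr0 mul0r.
have JA : JT T.+1 xA = 0 by exact: operator_xA.
have bnd x : `|JT T.+1 x| <= (a * K + C) * w x.
  have H : `|operator (JT T) x - operator (fun=> 0) x| <= a * phi 1 x.
    apply: operator_dist => // [|y]; first exact: Lp_cst.
    by rewrite subr0; exact: le_weight.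
  have -> : JT T.+1 x = (operator (JT T) x - operator (fun=> 0) x) + operator (fun=> 0) x.
    by rewrite subrK.
  apply: le_trans (ler_normD _ _) _; rewrite mulrDl; apply: lerD; last exact: HC.
  apply: le_trans H _; rewrite -mulrA ler_wpM2l//.
  by apply: le_trans (phi_le 1 x) _; rewrite ler_wpM2l.
have aKC : 0 <= a * K + C by rewrite addr_ge0// mulr_ge0.
split; last by exists (a * K + C).
split => //; apply: (Lp_le (g := fun x => (a * K + C) * w x)) => [||x].
- exact: operator_measurable.
- exact: LpZ.
- by rewrite [leRHS]ger0_norm// mulr_ge0.
Qed.

(** The increments satisfy |J_(T+1) - J_T| <= C phi_T. Summing them gives C (1 + K) wt, where 1
    comes from phi_0 and K from transience. *)
Let J_bound : exists2 a : R, 0 <= a & forall T x, `|JT T x| <= a * wt x.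
Proof.
have [C C0 HC] := operator0_bound.
have step T x : `|JT T.+1 x - JT T x| <= C * phi T x.
  elim: T x => [|T IH] x; last first.
    exact: (operator_dist C0 (J_good T.+1).1 (J_good T).1 IH).
  by rewrite [JT 0 x]/= subr0; exact: (le_weight (J_good 1).1 (J_good 1).2 C0 HC).
exists (C * (1 + K)) => [|T x]; first by rewrite mulr_ge0// addr_ge0.
have sumT : `|JT T x| <= C * \sum_(0 <= j < T) phi j x.
  elim: T => [|T IH]; first by rewrite big_geq//= normr0 mulr0.
  have -> : JT T.+1 x = JT T x + (JT T.+1 x - JT T x) by rewrite addrC subrK.
  rewrite big_nat_recr// [in leRHS]mulrDr.
  by apply: le_trans (ler_normD _ _) _; apply: lerD => //; exact: step.
apply: le_trans sumT _; rewrite -mulrA ler_wpM2l//.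
case: T => [|T]; first by rewrite big_geq// mulr_ge0// addr_ge0.
rewrite big_ltn// mulrDl mul1r lerD2l; exact: sum_phi_le.
Qed.

Lemma risk_fixpoint_iff v : V v -> wbounded w v ->
  ((forall x, x != xA -> v x = rho x (fun y => c x (pi x) y + v y)) /\ v xA = 0)
  <-> (forall x, JT T x @[T --> \oo] --> v x).
Proof.
move=> Vv [C C0 vC]; split=> [[vE vA] x|cJ].
  have v_fix y : v y = operator v y.
    by have [->|yA] := eqVneq y xA; [rewrite operator_xA|exact: vE].
  have dist T y : `|v y - JT T y| <= C * phi T y.
    elim: T y => [|T IH] y; first by rewrite subr0; apply: le_weight => //; exact: ltW.
    by rewrite v_fix; exact: (operator_dist (ltW C0) Vv (J_good T).1 IH).
  apply/cvgrPdist_le => e e0; have /cvgrPdist_le /(_ e e0) := phi_cvg0 C x.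
  apply: filterS => T; rewrite sub0r normrN => /(le_trans (ler_norm _)).
  exact/le_trans/dist.
have [a a0 Ja] := J_bound.
have step T n x : `|JT (T + n)%N x - JT T x| <= a * phi T x.
  elim: T x => [|T IH] x; first by rewrite add0n subr0; exact: Ja.
  exact: (operator_dist a0 (J_good (T + n)%N).1 (J_good T).1 IH).
(* The preceding estimate does not depend on n, so pointwise convergence is enough to pass it to [v]
   and then to compare [operator v] with J_(T+1). *)
have dist T x : `|v x - JT T x| <= a * phi T x.
  have cn : JT (T + n)%N x - JT T x @[n --> \oo] --> v x - JT T x.
    apply: cvgB; last exact: cvg_cst.
    rewrite (_ : (fun n => JT (T + n)%N x) = (fun n => JT (n + T)%N x)); last first.
      by apply/funext => n; rewrite addnC.
    by rewrite (cvg_shiftn T (fun n => JT n x)); exact: cJ.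
  have cn' : `|JT (T + n)%N x - JT T x| @[n --> \oo] --> `|v x - JT T x|.
    exact: cvg_norm cn.
  rewrite -(cvg_lim _ cn')//.
  apply: limr_le; first exact: cvgP cn'.
  by near=> n; exact: step.
have vA : v xA = 0.
  by have := dist 0%N xA; rewrite phi_xA mulr0 normr_le0 subr0 => /eqP.
split=> // x _; apply/esym.
have c1 : JT T.+1 x @[T --> \oo] --> v x by rewrite (cvg_shiftS (fun n => JT n x)).
have c2 : JT T.+1 x @[T --> \oo] --> operator v x.
  apply/cvgrPdist_le => e e0.
  have : a * phi T.+1 x @[T --> \oo] --> 0.
    by rewrite (cvg_shiftS (fun n => a * phi n x)); exact: phi_cvg0.
  move=> /cvgrPdist_le /(_ e e0); apply: filterS => T.
  rewrite sub0r normrN => /(le_trans (ler_norm _)); apply: le_trans.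
  exact: (operator_dist a0 Vv (J_good T).1 (dist T)).
exact: (cvg_unique _ c2 c1).
Unshelve. all: by end_near. Qed.

End controlled_model.
End Lp_space.

Unset Implicit Arguments.

Theorem theorem7p2 (R : realType) (dX dU : measure_display)
    (X : borelSpaceType R dX) (U : borelSpaceType R dU)
    (Uf : X -> set U) (Q : X -> U -> probability X R)
    (c : X -> U -> X -> R) (xA : X)
    (p : R) (P0 : probability X R) (w : X -> R)
    (sigma : (X -> R) -> X -> probability X R -> R) (pi : X -> U)
    (Uf_neq0 : forall x, Uf x !=set0)
    (Uf_meas : measurable_multifunction Uf)
    (Q_meas : controlled_kernel Uf Q)
    (xA_abs : absorbing Uf Q c xA)
    (p_ge1 : 1 <= p)
    (w_ge1 : forall x, 1 <= w x) (w_Lp : Lp P0 p w)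
    (sigma_risk : risk_transition_mapping P0 p sigma)
    (sigma_law : law_invariant P0 p sigma)
    (hG0 : G0 P0 p Uf Q) (hG1 : G1 Uf Q) (hG2 : G2 P0 p sigma)
    (hG3 : G3 Uf w c) (hG4 : G4 Uf)
    (pi_rule : decision_rule Uf pi)
    (transient : risk_transient P0 p Q sigma xA w pi)
    (v : X -> R) (v_Lp : Lp P0 p v) (v_wbnd : wbounded w v) :
  ((forall x, x != xA ->
      v x = sigma (fun y => c x (pi x) y + v y) x (Q x (pi x)))
    /\ v xA = 0)
  <-> (forall x, J Q c sigma pi T x @[T --> \oo] --> v x).
Proof.
exact: (risk_fixpoint_iff p_ge1 xA_abs w_ge1 w_Lp sigma_risk sigma_law hG0 hG1 hG3
  pi_rule transient v_Lp v_wbnd).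
Qed.
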